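(* Let $K$ be a number field with $s=t=1$ (one real place and one complex place) and let $u$ be a (totally) positive fundamental unit, i.e. $\mathcal{O}_K^{\times,+}$ is infinite cyclic generated by $u$. Then for every $n\geq 1$ the subgroup $U_n:=\langle u^n\rangle\subseteq\mathcal{O}_K^{\times,+}$ generated by $u^n$ is admissible, and for $X_n:=X(K,U_n)$ we have $$\lim_{n\to\infty}\frac{\log\left|H_1(X_n,\mathbb{Z})_{\mathrm{tor}}\right|}{n}=\log M(f),$$ where $f$ is the minimal polynomial of the unit $u$ (over $\mathbb{Q}$) and $M(f)$ denotes the Mahler measure of $f$. In particular, $\left|H_1(X_n,\mathbb{Z})_{\mathrm{tor}}\right|$ always grows asymptotically exponentially as $n\to+\infty$ (that is, the limit is strictly positive).
   Context: Let $\sigma_1,\dots,\sigma_s:K\to\mathbb{R}$ be the real embeddings and $\sigma_{s+1},\dots,\sigma_{s+t}:K\to\mathbb{C}$ representatives of the conjugate pairs of genuinely complex embeddings; $\underline{\sigma}=(\sigma_1,\dots,\sigma_{s+t})$. $\mathcal{O}_K^{\times,+}$ is the group of units that are positive under all real embeddings. A subgroup $U\subseteq\mathcal{O}_K^{\times,+}$ is admissible (Oeljeklaus--Toma) if it is free abelian of rank $s$ and $\{(\log\sigma_1(u),\dots,\log\sigma_s(u)):u\in U\}$ is a full lattice in $\mathbb{R}^s$. Then $X(K,U):=(\mathbb{H}^s\times\mathbb{C}^t)/(\mathcal{O}_K\rtimes U)$, where $\mathbb{H}$ is the upper half plane and $(a,u)\in\mathcal{O}_K\rtimes U$ acts by $\underline{z}\mapsto\underline{\sigma}(u)\underline{z}+\underline{\sigma}(a)$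 (coordinatewise product), is a compact complex manifold. For an abelian group $G$, $G_{\mathrm{tor}}$ is its torsion subgroup. The Mahler measure of a monic polynomial $f=\prod_j(T-\alpha_j)\in\mathbb{C}[T]$ is $M(f)=\prod_j\max(1,|\alpha_j|)$. *)

(* Defs.v *)
From HB Require Import structures.
From mathcomp Require Import freeg.
From mathcomp Require Import all_boot all_order all_algebra all_field.
From mathcomp Require Import complex finmap.
From mathcomp Require Import all_classical all_reals all_analysis.

Set Implicit Arguments.
Unset Strict Implicit.
Unset Printing Implicit Defensive.

Import Order.TTheory GRing.Theory Num.Theory.
Import numFieldNormedType.Exports.

Local Open Scope classical_set_scope.
Local Open Scope ring_scope.

(* Canonical inference finds the norm topology of the concrete type [R[i]] only
   on the regular module [R[i]^o]. *)
Section complex_topology.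
Context {R : rcfType}.
HB.instance Definition _ := NormedModule.copy R[i] R[i]^o.
End complex_topology.

Section singular_homology.
Context (R : realType) (T : topologicalType).

Definition simplex n : set 'rV[R]_n.+1 :=
  [set x | (forall i, 0 <= x ord0 i) /\ \sum_i x ord0 i = 1].
#[global] Arguments simplex : clear implicits.

(* The i-th face inclusion: insert a zero coordinate at position i. *)
Definition coface_mx n (i : 'I_n.+2) (x : 'rV[R]_n.+1) : 'rV[R]_n.+2 :=
  \row_j (if unlift i j is Some k then x ord0 k else 0).

Lemma coface_subproof n (i : 'I_n.+2) (x : simplex n) :
  coface_mx i (set_val x) \in simplex n.+1.
Proof.
have [x0 x1] := set_valP x; apply/mem_set; split=> [j|].
  by rewrite mxE; case: unliftP => [k _|_] //; exact: x0.
rewrite -[RHS]x1 (bigD1_ord i)//= mxE unlift_none add0r.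
by apply: eq_bigr => k _; rewrite mxE liftK.
Qed.

Definition coface n (i : 'I_n.+2) (x : simplex n) : simplex n.+1 :=
  exist (fun y => y \in simplex n.+1) (coface_mx i (set_val x)) (coface_subproof i x).

Lemma coface_continuous n (i : 'I_n.+2) : continuous (@coface n i).
Proof.
apply: continuous_comp_initial => x A [P xP PA].
pose V := set_val x.
pose Q (a : 'I_1) (k : 'I_n.+1) := P a (lift i k).
have xQ : nbhs V [set y : 'rV[R]_n.+1 | forall a k, Q a k (y a k)].
  exists Q => // a k; have := xP a (lift i k).
  by rewrite !ord1 /= !mxE liftK.
have : nbhs x (set_val @^-1` [set y : 'rV[R]_n.+1 | forall a k, Q a k (y a k)]).
  exact: (@initial_continuous _ _ set_val).
apply: filterS => y Qy; apply: PA => a j /=.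
rewrite mxE; case: unliftP => [k ->|ji]; first by move: (Qy a k); rewrite /Q (ord1 a).
by have := nbhs_singleton (xP a j); rewrite ord1 /= mxE ji unlift_none.
Qed.

HB.instance Definition _ n (i : 'I_n.+2) :=
  isContinuous.Build _ _ (@coface n i) (@coface_continuous n i).

Definition singular_simplex n := continuousType (simplex n) T.

Definition face n (i : 'I_n.+2) (s : singular_simplex n.+1) :
  singular_simplex n := s \o @coface n i.

Definition chain n := {freeg (singular_simplex n) / int}.

Definition boundary n : chain n.+1 -> chain n :=
  fglift (fun s => \sum_(i < n.+2) (-1) ^+ i *: << face i s >>).

Lemma boundaryB n : {morph @boundary n : x y / x - y}.
Proof. exact: lift_is_additive. Qed.

Definition is_cycle : {pred chain 1} := [pred c | boundary c == 0].

Lemma is_cycle_zmod_closed : zmod_closed is_cycle.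
Proof.
split=> [|x y]; first by rewrite inE -(subrr 0) boundaryB subrr.
by rewrite !inE boundaryB => /eqP-> /eqP->; rewrite subrr.
Qed.

HB.instance Definition _ :=
  GRing.isZmodClosed.Build (chain 1) is_cycle is_cycle_zmod_closed.

Definition cycles := {c : chain 1 | c \in is_cycle}.

HB.instance Definition _ := SubChoice.on cycles.
HB.instance Definition _ := [SubChoice_isSubZmodule of cycles by <:].

(* Boundaries are taken inside the group of cycles, so that H_1 is a quotient
   of [cycles]; no proof that two boundary maps compose to zero is required. *)
Definition is_boundary : {pred cycles} :=
  [pred c : cycles | `[< exists d : chain 2, boundary d = val c >]].

Lemma is_boundary_zmod_closed : zmod_closed is_boundary.
Proof.
split=> [|x y].
  by apply/asboolP; exists 0; rewrite -(subrr 0) boundaryB subrr raddf0.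
move=> /asboolP[c cx] /asboolP[d dy]; apply/asboolP.
by exists (c - d); rewrite boundaryB cx dy raddfB.
Qed.

HB.instance Definition _ :=
  GRing.isZmodClosed.Build cycles is_boundary is_boundary_zmod_closed.

Definition H1 : zmodType := Quotient.quot is_boundary.

End singular_homology.

Definition torsion (A : zmodType) : set A :=
  [set x | exists2 m : nat, (0 < m)%N & x *+ m = 0].
Arguments torsion : clear implicits.

Section number_field.
Context (K : fieldExtType rat) (R : realType).

Definition is_int (x : K) : Prop := integralOver (intr : int -> K) x.

Definition nonreal (tau : K -> R[i]) : Prop := exists x, complex.Im (tau x) != 0.

(* [embeddings s t] : the number field [K] has exactly [s] real embeddings,
   listed as [esigma_re], and exactly [t] conjugate pairs of non-real complex
   embeddings, with representatives [esigma_im]. *)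
Record embeddings (s t : nat) := Embeddings {
  esigma_re : 'I_s -> {rmorphism K -> R};
  esigma_im : 'I_t -> {rmorphism K -> R[i]};
  esigma_reP : forall tau : {rmorphism K -> R},
    exists! j, tau =1 esigma_re j;
  esigma_im_nonreal : forall j, nonreal (esigma_im j);
  esigma_imP : forall tau : {rmorphism K -> R[i]}, nonreal tau ->
    exists! j, tau =1 esigma_im j \/ tau =1 (fun x => conjc (esigma_im j x)) }.

Context (s t : nat) (sigma : embeddings s t).

(* The group O_K^{x,+} of units positive under all real embeddings. *)
Definition pos_units : set K :=
  [set v | [/\ v != 0, is_int v, is_int v^-1 &
               forall j, 0 < esigma_re sigma j v]].

Definition is_subgroup (U : set K) : Prop :=
  [/\ U 1, forall v w, U v -> U w -> U (v * w) & forall v, U v -> U v^-1].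

Definition free_abelian_of_rank (r : nat) (U : set K) : Prop :=
  exists e : 'I_r -> K,
    U = [set v | exists m : 'I_r -> int, v = \prod_i e i ^ m i] /\
    forall m m' : 'I_r -> int,
      \prod_i e i ^ m i = \prod_i e i ^ m' i -> m =1 m'.

(* The Z-span of a basis of R^r (the rows of an invertible matrix). *)
Definition full_lattice (r : nat) (L : set 'rV[R]_r) : Prop :=
  exists2 B : 'M[R]_r, B \in unitmx &
    L = [set v | exists m : 'rV[int]_r, v = map_mx intr m *m B].

Definition log_embedding (v : K) : 'rV[R]_s :=
  \row_j ln (esigma_re sigma j v).

Definition admissible (U : set K) : Prop :=
  [/\ U `<=` pos_units, is_subgroup U, free_abelian_of_rank s U &
      full_lattice (log_embedding @` U)].

Definition HsCt : set ('rV[R[i]]_s * 'rV[R[i]]_t) :=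
  [set z : 'rV[R[i]]_s * 'rV[R[i]]_t | forall j : 'I_s,
    0 < complex.Im (z.1 ord0 j)].

Definition OT_act (a v : K) (z : 'rV[R[i]]_s * 'rV[R[i]]_t) :
    'rV[R[i]]_s * 'rV[R[i]]_t :=
  (\row_j ((esigma_re sigma j v)%:C%C * z.1 ord0 j + (esigma_re sigma j a)%:C%C),
   \row_j (esigma_im sigma j v * z.2 ord0 j + esigma_im sigma j a)).

Section OT_manifold.
Context (U : set K).

Definition OT_orbit (z : HsCt) : set HsCt :=
  [set w | exists a v, [/\ is_int a, U v &
                           set_val w = OT_act a v (set_val z)]].

(* Two points are identified when their orbits are equal as sets. This is an
   equivalence relation for any [U]; when [U] is a subgroup of [pos_units] it
   says that the points lie in the same orbit of O_K x| U. *)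
Definition OT_rel (z w : HsCt) : bool := `[< OT_orbit z = OT_orbit w >].

Lemma OT_rel_equiv : equiv_class_of OT_rel.
Proof.
split=> [z|z w|w z y]; first exact/asboolP.
  by apply: asbool_equiv_eq; split=> ->.
by rewrite /OT_rel => /asboolP-> /asboolP->; exact/asboolP.
Qed.

Canonical OT_rel_equiv_rel := EquivRelPack OT_rel_equiv.

Definition OT_manifold : topologicalType :=
  quotient_topology {eq_quot OT_rel}%qT.

End OT_manifold.

End number_field.

Definition cyclic_subgroup (K : fieldType) (v : K) : set K :=
  [set v ^ m | m in [set: int]].

(* Mahler measure of a monic polynomial: the sequence consists of its roots
   with multiplicity. *)
Definition mahler (R : realType) (f : {poly R[i]}) : R :=
  \prod_(z <- sval (closed_field_poly_normal f)) Num.max 1 (Normc.normc z).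

(* Main.v *)
(* Here G = O_K x| <u^n> acts freely and properly discontinuously on the convex set
   H x C, so H_1(X_n) is the abelianization O_K/(u^n - 1) + Z of G, and its torsion
   has order |N(u^n - 1)| = |s1(u)^n - 1| |s2(u)^n - 1|^2 for the real embedding s1
   and the complex embedding s2. Since N(u) = s1(u) |s2(u)|^2 = 1 and s1(u) <> 1,
   exactly one of s1(u) and |s2(u)|^2 exceeds 1 and it equals M(f); hence the order
   lies between two positive multiples of M(f)^n.

   The isomorphism H_1 = G^ab is obtained on chains, without the fundamental group.
   Choose a lift s(x) of every point x. A singular 1-simplex from x to x' lifts to a
   path from s(x) to g s(x'), and simplex |-> [g] in G^ab kills boundaries because
   2-simplices lift. Modulo boundaries the lifted path is the segment from s(x) to
   g s(x'), hence the sum of the segments from s(x) to y0, from y0 to g y0 and from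
   g y0 to g s(x'). By equivariance the outer two cancel over a cycle, so the class
   of a cycle is the image of [g] under a map from G^ab.

   O_K is free of rank 3 because x |-> (Tr x, Tr xu, Tr xu^2) embeds it in Z^3 as a
   subgroup of full rank, and the order of O_K/(u^n - 1) is the absolute value of the
   determinant of multiplication by u^n - 1, by the Smith normal form. *)
From HB Require Import structures.
From mathcomp Require Import freeg.
Require Import Defs.
From mathcomp Require Import all_boot all_order all_algebra all_field.
From mathcomp Require Import complex finmap.
From mathcomp Require Import all_classical all_reals all_analysis.
From mathcomp Require Import ring lra.
Set Implicit Arguments.
Unset Strict Implicit.
Unset Printing Implicit Defensive.
Import Order.TTheory GRing.Theory Num.Theory.
Import numFieldNormedType.Exports.
Local Open Scope classical_set_scope.
Local Open Scope ring_scope.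
(** * Lifting through a covering *)

(** The covering Y -> X enters through three properties: the projection is open, it is locally
    injective, and deck maps act transitively on its fibres. Homogeneity of the fibres lets a local
    lift be moved through any prescribed point. The obstacle is to lift 2-simplices continuously,
    not just paths: the simplex is written as a retract of the whole vector space, and maps on a
    ball are lifted along rays from the origin. The abelianization is used through its universal
    property, because the group it must map to consists of all 1-chains modulo boundaries, where
    segments that are not cycles also have classes. Discreteness of the action is arithmetic: the
    powers of s1(v) other than 1 stay away from 1, and an algebraic integer whose conjugates are so
    small that its norm is below 1 in absolute value is zero. In the growth estimate, s1(u)
    |s2(u)|^2 = 1 with s1(u) <> 1 keeps every conjugate of u off the unit circle. The distance from
    an n-th power to 1 is then bounded below by a constant (modulus below 1) or by a constant times
    the power itself (modulus above 1). *)

Section clamp.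
Context (R : realType).

(** Turns parameters in [0, 1] into parameters on the whole line: paths can then be compared by
    connectedness of the line, and convex combinations stay in a convex set for every real
    parameter. *)
Definition clamp (t : R) : R := Num.max 0 (Num.min t 1).

Lemma clamp_ge0 t : 0 <= clamp t.
Proof. by rewrite /clamp le_max lexx. Qed.

Lemma clamp_le1 t : clamp t <= 1.
Proof. by rewrite /clamp ge_max ler01 ge_min lexx orbT. Qed.

Lemma clamp_id t : 0 <= t -> t <= 1 -> clamp t = t.
Proof. by move=> t0 t1; rewrite /clamp (min_idPl t1) (max_idPr t0). Qed.

Lemma clamp0 : clamp 0 = 0.
Proof. by rewrite clamp_id. Qed.

Lemma clamp1 : clamp 1 = 1.
Proof. by rewrite clamp_id. Qed.

Lemma clamp_continuous : continuous clamp.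
Proof.
move=> t; apply: (@continuous_max R R (fun=> 0) (fun t => Num.min t 1)).
  exact: cvg_cst.
by apply: (@continuous_min R R id (fun=> 1)) => //; exact: cvg_cst.
Qed.

End clamp.

Section covering.
Context (R : realType) (Y X : topologicalType) (p : Y -> X).
Hypotheses (hausdorffY : hausdorff_space Y)
  (p_open : forall A, open A -> open (p @` A))
  (p_inj : forall y : Y, exists2 W : set Y, nbhs y W &
    forall a b, W a -> W b -> p a = p b -> a = b)
  (p_deck : forall y y', p y = p y' ->
    exists g : Y -> Y, [/\ continuous g, forall z, p (g z) = p z & g y = y']).

Lemma lifts_agree_nbhs (T : topologicalType) (l l' : T -> Y) (x : T) :
  {for x, continuous l} -> {for x, continuous l'} ->
  (\forall z \near x, p (l z) = p (l' z)) -> l x = l' x ->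
  \forall z \near x, l z = l' z.
Proof.
move=> lx l'x pll' llx; have [W Wy Winj] := p_inj (l x).
have lW : \forall z \near x, W (l z) by exact: (lx W).
have l'W : \forall z \near x, W (l' z) by apply: (l'x W); rewrite -llx.
by near=> z; apply: Winj; near: z.
Unshelve. all: by end_near. Qed.

(* The set where the lifts agree is open and closed. *)
Lemma lift_unique (l l' : R -> Y) : continuous l -> continuous l' ->
  (forall t, p (l t) = p (l' t)) -> l 0 = l' 0 -> forall t, l t = l' t.
Proof.
move=> lc l'c pll' ll0 t; pose S := [set t | l t = l' t].
suff ST : S = setT by have : S t by rewrite ST.
have conn : connected [set: R] by apply/connected_intervalP => ? *.
apply: (conn S); first by exists 0.
- exists S; rewrite ?setTI// openE => s Ss.
  have pl : \forall z \near s, p (l z) = p (l' z) by apply: (@nearW _ (nbhs s) _ (nbhs_filter s)) => z; exact: pll'.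
  exact: (lifts_agree_nbhs (lc s) (l'c s) pl Ss).
- exists S; rewrite ?setTI//.
  rewrite -[S]setCK closedC openE => s /= Ss.
  have /eqP nss : l s <> l' s by [].
  move: (hausdorffY); rewrite open_hausdorff => /(_ _ _ nss)[[A B] /=] [].
  rewrite !inE => As Bs [oA oB AB].
  have h1 : \forall z \near s, A (l z) by apply: (lc s A); exact: open_nbhs_nbhs.
  have h2 : \forall z \near s, B (l' z) by apply: (l'c s B); exact: open_nbhs_nbhs.
  near=> z => /= Sz.
  have : (A `&` B) (l z) by split; [near: z | rewrite Sz; near: z].
  by rewrite AB.
Unshelve. all: by end_near. Qed.

(** [L] picks preimages in an open set W on which p is injective. Openness of p is used twice: it
    makes the domain open, and it makes [L] continuous, since for B' open the points whose value
    lies in B' include the open set of all z with f z in p(W [&] B'). *)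
Lemma local_lift (T : topologicalType) (f : T -> X) (x : T) (y : Y) :
  continuous f -> p y = f x -> exists L : T -> Y, exists N : set T,
  [/\ open N, N x & forall z, N z -> p (L z) = f z /\ {for z, continuous L}].
Proof.
move=> fc pyx; have [W0 Wy0 Winj0] := p_inj y.
have [W oW [Wy WW0]] : exists2 W, open W & W y /\ W `<=` W0.
  by move: Wy0; rewrite nbhsE => -[W [? ?] ?]; exists W.
have Winj a b : W a -> W b -> p a = p b -> a = b by move=> /WW0 ? /WW0 ?; exact: Winj0.
pose N := f @^-1` (p @` W).
have ex z : exists w, N z -> W w /\ p w = f z.
  have [[w Ww pw]|nNz] := pselect (N z); first by exists w.
  by exists y.
have [L LP] := choice ex; exists L, N; split.
- by apply: open_comp => [z _|]; [exact: fc | exact: p_open].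
- by exists y.
move=> z Nz; have [WL pL] := LP z Nz; split=> // B.
rewrite nbhsE => -[B' [oB' B'L] B'B].
have oWB : open (p @` (W `&` B')) by apply: p_open; exact: openI.
have h1 : \forall t \near z, (p @` (W `&` B')) (f t).
  apply: (fc z); apply: open_nbhs_nbhs; split => //.
  by rewrite -pL; exists (L z).
apply: filterS h1 => t [w [Ww B'w] pw].
have [WLt pLt] : W (L t) /\ p (L t) = f t by apply: LP; exists w.
by apply: B'B; rewrite (Winj (L t) w) // pLt.
Qed.

Local Notation V n := 'rV[R]_n.+1.

(** A Lebesgue number argument: compactness of the closed ball gives one radius [d] that serves
    every centre. A deck map then moves the local lift so that it takes the value [y] at the
    centre. *)
Lemma uniform_lift n (f : V n -> X) (C : R) : continuous f ->
  (forall x, exists y, p y = f x) ->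
  exists2 d : R, 0 < d & forall (x : V n) y, `|x| <= C -> p y = f x ->
    exists L : V n -> Y, L x = y /\
      forall z : V n, ball x d z -> p (L z) = f z /\ {for z, continuous L}.
Proof.
move=> fc f_surj; pose K := [set x : V n | `|x| <= C].
have cK : compact K.
  apply: bounded_closed_compact; first by exists C; split=> [|c Cc x /= /le_trans->//]; [exact: num_real|exact: ltW].
  apply: (@closed_comp _ _ (fun x : V n => `|x|) [set r | r <= C]) => [x _|].
    exact: norm_continuous.
  exact: closed_le.
pose P (d : R) (x : V n) := exists L : V n -> Y,
  forall z : V n, ball x d z -> p (L z) = f z /\ {for z, continuous L}.
have [] := (iffLR (compact_near_coveringP K) cK R (0^'+) P _).
  move=> x Kx; have [y pyx] := f_surj x.
  have [L [N [oN Nx LP]]] := local_lift fc pyx.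
  have : nbhs x N by exact: open_nbhs_nbhs.
  move=> /nbhs_ballP[e /= e0 eN].
  have e20 : 0 < e / 2 by rewrite divr_gt0.
  exists (ball x (e / 2), [set d : R | 0 < d < e / 2]) => /=.
    split; first exact: nbhsx_ballx.
    by near=> d; apply/andP; split; [near: d; exact: nbhs_right_gt | near: d; exact: nbhs_right_lt].
  move=> [x' d] [/= xx' /andP[d0 de]]; exists L => z zd; apply: LP; apply: eN.
  by apply: (@ball_split _ _ x') => //; apply: le_ball zd; exact: ltW.
move=> e /= e0 /(_ (e / 2)) Pe.
have e20 : 0 < e / 2 by rewrite divr_gt0.
exists (e / 2) => // x y Kx pyx.
have [L LP] : P (e / 2) x.
  apply: Pe => //=.
  by rewrite sub0r normrN gtr0_norm// ltr_pdivrMr// mulr_natr mulr2n ltrDl.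
have [pL _] := LP x (ballxx x e20).
have [g [gc pg gy]] := p_deck (etrans pL (esym pyx)).
exists (g \o L); split => // z /LP[pLz Lz]; split; first by rewrite /= pg.
by apply: continuous_comp => //; exact: gc.
Unshelve. all: by end_near. Qed.

(* Lift f(t x) in N steps t = k/N so short that each step stays in a ball on which
   f has a local lift. *)
Lemma lift_ball n (f : V n -> X) (C : R) (y0 : Y) : 0 < C -> continuous f ->
  (forall x, exists y, p y = f x) -> p y0 = f 0 ->
  exists2 l : V n -> Y, l 0 = y0 &
    forall x : V n, `|x| < C -> p (l x) = f x /\ {for x, continuous l}.
Proof.
move=> C0 fc f_surj py0; have [d d0 Ld] := uniform_lift C fc f_surj.
have [N0 CN0] : exists N : nat, C / d < N%:R.
  by exists (Num.truncn (C / d)).+1; exact: truncnS_gt.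
pose N := N0.+1.
have N_gt0 : 0 < N%:R :> R by rewrite ltr0n.
have CN : C / N%:R < d.
  rewrite ltr_pdivrMr// mulrC -ltr_pdivrMr//; apply: lt_trans CN0 _.
  by rewrite ltr_nat.
pose r k : R := k%:R / N%:R.
have rD k : r k.+1 = r k + N%:R^-1 by rewrite /r -natr1 mulrDl mul1r.
have r_ge0 k : 0 <= r k by rewrite divr_ge0.
have r_le1 k : (k <= N)%N -> r k <= 1.
  by move=> kN; rewrite ler_pdivrMr// mul1r ler_nat.
have scale_cont (c : R) : continuous (fun x : V n => c *: x).
  by move=> x; exact: scaler_continuous.
suff H k : (k <= N)%N -> exists2 l : V n -> Y, l 0 = y0 &
    forall x : V n, `|x| < C -> p (l x) = f (r k *: x) /\ {for x, continuous l}.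
  have [l l0 lP] := H N (leqnn N); exists l => // x xC.
  by have := lP x xC; rewrite /r divff ?gt_eqF// scale1r.
elim: k => [_|k IH kN].
  exists (fun=> y0) => // x _; split; last exact: (@cst_continuous _ _ y0 x).
  by rewrite /r mul0r scale0r.
have [l l0 lP] := IH (ltnW kN).
have ex (x : V n) : exists L : V n -> Y, `|x| < C -> L (r k *: x) = l x /\
    forall z : V n, ball (r k *: x) d z -> p (L z) = f z /\ {for z, continuous L}.
  have [xC|xC] := boolP (`|x| < C); last by exists (fun=> y0).
  have [plx _] := lP x xC.
  have rxC : `|r k *: x| <= C.
    rewrite normrZ ger0_norm//; apply: le_trans (ltW xC).
    by rewrite ler_piMl// r_le1// ltnW.
  by have [L LP] := Ld _ _ rxC plx; exists L.
have [L LP] := choice ex.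
have near_center (x : V n) : `|x| < C -> forall s : R, 0 <= s <= 1 ->
    `|r k *: x - (r k + s / N%:R) *: x| < d.
  move=> xC s /andP[s0 s1]; rewrite -scalerBl opprD addrA subrr sub0r.
  rewrite normrZ normrN ger0_norm ?divr_ge0//; apply: le_lt_trans CN.
  rewrite mulrAC ler_wpM2r ?invr_ge0//; apply: le_trans (ltW xC).
  by rewrite ler_piMl.
have near_center1 (x : V n) : `|x| < C -> `|r k *: x - r k.+1 *: x| < d.
  by move=> xC; have := near_center x xC 1; rewrite mul1r -rD; apply; rewrite ler01 lexx.
(* The next value at x comes from the local lift chosen for x itself. These choices do not depend
   continuously on x, so continuity has to be recovered by comparing neighbouring choices. *)
exists (fun x => L x (r k.+1 *: x)) => [|x xC].
  by have [] := LP 0 _; rewrite ?normr0// !scaler0 l0.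
have [Lc LB] := LP x xC; have [plx lx] := lP x xC.
have ball_path (x' : V n) (s : R) : `|x'| < C -> 0 <= s <= 1 ->
    ball (r k *: x') d ((r k + s / N%:R) *: x').
  by move=> x'C s01; rewrite -ball_normE /=; exact: near_center.
(* Both local lifts cover f along the step from [r k *: x'] to [r k.+1 *: x'] and start at the same
   point [l x']; uniqueness of path lifting makes them end at the same point. Near x the new lift is
   thus the single continuous function [L x], evaluated at [r k.+1 *: x']. *)
have agree : \forall x' \near x, L x (r k.+1 *: x') = L x' (r k.+1 *: x').
  have xx'C : \forall x' \near x, `|x'| < C.
    have := @norm_continuous _ _ x; move/(_ [set t | t < C]); apply.
    by apply: open_nbhs_nbhs; split => //; exact: open_lt.
  have Llx' : \forall x' \near x, (L x \o (fun z => r k *: z)) x' = l x'.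
    apply: lifts_agree_nbhs => //.
    - apply: continuous_comp; first exact: scale_cont.
      by have [] := LB _ (ballxx _ d0).
    - near=> x'.
      have x'C : `|x'| < C by near: x'.
      have [-> _] := lP x' x'C.
      have [] // := LB (r k *: x') _.
      near: x'.
      have := @scale_cont (r k) x; apply.
      exact: nbhsx_ballx.
  have d' : 0 < d - C / N%:R by rewrite subr_gt0.
  near=> x'.
  have x'C : `|x'| < C by near: x'.
  have [Lc' LB'] := LP x' x'C.
  (* One step has length at most C / N, so this margin keeps the whole step that starts at
     [r k *: x'] inside the ball of radius [d] about [r k *: x]. *)
  have xx' : `|x - x'| < d - C / N%:R.
    by near: x'; apply/nbhs_ballP; exists (d - C / N%:R) => //= z; rewrite -ball_normE.
  pose c (t : R) := (r k + clamp t / N%:R) *: x'.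
  have cc : continuous c.
    move=> t; apply: cvgZr_tmp; apply: cvgD; first exact: cvg_cst.
    by apply: cvgMl; exact: clamp_continuous.
  have in01 (t : R) : 0 <= clamp t <= 1 by rewrite clamp_ge0 clamp_le1.
  have cB' t : ball (r k *: x') d (c t) by exact: ball_path.
  have cB t : ball (r k *: x) d (c t).
    rewrite -ball_normE /= /c.
    have -> : r k *: x - (r k + clamp t / N%:R) *: x' =
        r k *: (x - x') + (r k *: x' - (r k + clamp t / N%:R) *: x').
      by rewrite scalerBr addrA subrK.
    apply: le_lt_trans (ler_normD _ _) _.
    rewrite -[ltRHS](subrK (C / N%:R)); apply: ltr_leD.
      rewrite normrZ ger0_norm//; apply: le_lt_trans xx'.
      by rewrite ler_piMl// r_le1// ltnW.
    rewrite -scalerBl opprD addrA subrr sub0r normrZ normrN ger0_norm ?divr_ge0 ?clamp_ge0//.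
    rewrite mulrAC ler_wpM2r ?invr_ge0//; apply: le_trans (ltW x'C).
    by rewrite ler_piMl// clamp_le1.
  have : forall t, (L x \o c) t = (L x' \o c) t.
    apply: lift_unique => [t|t|t|] /=.
    - by apply: continuous_comp; [exact: cc | have [] := LB _ (cB t)].
    - by apply: continuous_comp; [exact: cc | have [] := LB' _ (cB' t)].
    - by have [-> _] := LB _ (cB t); have [-> _] := LB' _ (cB' t).
    - rewrite /c clamp0 mul0r addr0 Lc'.
      by near: x'; exact: Llx'.
  by move/(_ 1); rewrite /= /c clamp1 mul1r -rD.
split.
  by have [] // := LB (r k.+1 *: x); rewrite -ball_normE; exact: near_center1.
have c1 : {for x, continuous (fun x' : V n => L x (r k.+1 *: x'))}.
  apply: (@continuous_comp _ _ _ (fun x' : V n => r k.+1 *: x') (L x)).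
    exact: scale_cont.
  by have [] // := LB (r k.+1 *: x); rewrite -ball_normE; exact: near_center1.
move=> A nA; exact: (@filterS2 _ (nbhs x) (nbhs_filter x) _ _ _
  (fun z (e : _ = _) (Az : A _) => eq_ind _ A Az _ e) agree (c1 A nA)).
Unshelve. all: by end_near. Qed.

End covering.

(** * Continuity in coordinates, and lifting of maps defined on simplices *)

Lemma rV_continuous (T U : topologicalType) n (f : T -> 'rV[U]_n.+1) :
  (forall j, continuous (fun x => f x ord0 j)) -> continuous f.
Proof.
move=> fc x A [P xP PA].
have : \forall z \near x, forall j, P ord0 j (f z ord0 j).
  by apply: filter_forall => j; apply: (fc j x); rewrite -?ord1; exact: xP.
by apply: filterS => z Pz; apply: PA => a j; rewrite ord1.
Qed.

(* Stated over an abstract domain: on matrix spaces the search for the filter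
   instance unfolds [nbhs] and fails, so [cvgD] and the like do not apply there. *)
Section pointwise_continuity.
Context (K : numFieldType) (T : topologicalType).

Lemma fun_cst_continuous (U : topologicalType) (u : U) :
  continuous ((fun=> u) : T -> U).
Proof. by move=> x; exact: cvg_cst. Qed.

Lemma fun_addr_continuous (V : normedModType K) (f g : T -> V) :
  continuous f -> continuous g -> continuous (fun x => f x + g x).
Proof. by move=> fc gc x; apply: cvgD; [exact: fc | exact: gc]. Qed.

Lemma fun_subr_continuous (V : normedModType K) (f g : T -> V) :
  continuous f -> continuous g -> continuous (fun x => f x - g x).
Proof. by move=> fc gc x; apply: cvgB; [exact: fc | exact: gc]. Qed.

Lemma fun_mulr_continuous (f g : T -> K) :
  continuous f -> continuous g -> continuous (fun x => f x * g x).
Proof. by move=> fc gc x; apply: cvgM; [exact: fc | exact: gc]. Qed.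

Lemma fun_scaler_continuous (V : normedModType K) (f : T -> K) (g : T -> V) :
  continuous f -> continuous g -> continuous (fun x => f x *: g x).
Proof. by move=> fc gc x; apply: cvgZ; [exact: fc | exact: gc]. Qed.

Lemma fun_invr_continuous (f : T -> K) : (forall x, f x != 0) ->
  continuous f -> continuous (fun x => (f x)^-1).
Proof. by move=> f0 fc x; apply: cvgV; [exact: f0 | exact: fc]. Qed.

End pointwise_continuity.

Section simplex_topology.
Context (R : realType).
Implicit Types n : nat.

Lemma simplex_continuous (T : topologicalType) n (f : T -> @simplex R n) :
  (forall j, continuous (fun x => set_val (f x) ord0 j)) -> continuous f.
Proof. by move=> fc; apply: continuous_comp_initial; exact: rV_continuous. Qed.

Lemma coord_continuous_simplex n j :
  continuous (fun x : @simplex R n => set_val x ord0 j).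
Proof.
move=> x; apply: (@continuous_comp _ _ _ set_val (fun y : 'rV_n.+1 => y ord0 j)).
  exact: (@initial_continuous _ _ set_val).
exact: coord_continuous.
Qed.

Definition possum n (x : 'rV[R]_n.+1) : R := \sum_j Num.max 0 (x ord0 j).

(* Take positive parts, put the deficit of their sum to 1 on the first coordinate and
   normalize: a retraction defined on the whole space. *)
Definition retract_mx n (x : 'rV[R]_n.+1) : 'rV[R]_n.+1 :=
  let m := Num.max 1 (possum x) in
  \row_j ((Num.max 0 (x ord0 j) + (m - possum x) *+ (j == ord0)) / m).

Lemma retract_subproof n (x : 'rV[R]_n.+1) : retract_mx x \in (@simplex R n).
Proof.
have m0 : 0 < Num.max 1 (possum x) by rewrite lt_max ltr01.
apply/mem_set; split=> [j|].
  rewrite mxE divr_ge0 ?(ltW m0)// addr_ge0 ?le_max ?lexx//.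
  by rewrite mulrn_wge0// subr_ge0 le_max lexx orbT.
under eq_bigr do rewrite mxE.
rewrite -mulr_suml big_split/= -/(possum x) (bigD1 ord0)//= big1 => [|i /negPf->//].
by rewrite addr0 addrC subrK divff// gt_eqF.
Qed.

Definition simplex_retract n (x : 'rV[R]_n.+1) : @simplex R n :=
  exist (fun y => y \in (@simplex R n)) (retract_mx x) (retract_subproof x).

Lemma simplex_retractK n (x : @simplex R n) : simplex_retract (set_val x) = x.
Proof.
apply: val_inj; have [x0 x1] := set_valP x; apply/rowP => j /=; rewrite mxE.
have -> : possum (set_val x) = 1.
  by rewrite -x1; apply: eq_bigr => i _; rewrite (max_idPr (x0 i)).
by rewrite maxxx subrr mul0rn addr0 divr1 (max_idPr (x0 j)).
Qed.

Lemma simplex_retract_continuous n : continuous (@simplex_retract n).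
Proof.
have maxc (f g : 'rV[R]_n.+1 -> R) : continuous f -> continuous g ->
    continuous (fun x => Num.max (f x) (g x)).
  by move=> fc gc x; apply: continuous_max; [exact: fc | exact: gc].
have posc j : continuous (fun x : 'rV[R]_n.+1 => Num.max 0 (x ord0 j)).
  by apply: maxc; [exact: fun_cst_continuous | exact: coord_continuous].
have sumc : continuous (@possum n).
  by apply: continuous_big => [|j _]; [exact: add_continuous | exact: posc].
have mc : continuous (fun x : 'rV[R]_n.+1 => Num.max 1 (possum x)).
  by apply: maxc => //; exact: fun_cst_continuous.
apply: simplex_continuous => j /=.
under eq_fun do rewrite mxE.
apply: fun_mulr_continuous; last first.
  by apply: fun_invr_continuous => // x; rewrite gt_eqF// lt_max ltr01.
apply: fun_addr_continuous; first exact: posc.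
under eq_fun do rewrite -mulr_natr.
apply: fun_mulr_continuous; last exact: fun_cst_continuous.
exact: fun_subr_continuous.
Qed.

Lemma simplex_bounded n : exists2 C : R, 0 < C &
  forall x : @simplex R n, `|set_val x| < C.
Proof.
have cK : compact [set v : 'rV[R]_n.+1 | forall i, `[0, 1]%classic (v ord0 i)].
  by apply: (@rV_compact R n.+1 (fun=> `[0, 1]%classic)) => i; exact: segment_compact.
have [M [_ MP]] := compact_bounded cK.
have C0 : 0 < `|M| + 2 by rewrite ltr_wpDl.
exists (`|M| + 2) => // x; apply: (@le_lt_trans _ _ (`|M| + 1)).
  apply: MP => /=; first by rewrite (le_lt_trans (ler_norm M))// ltrDl.
  have [x0 x1] := set_valP x => i; rewrite /= in_itv /= x0 /=.
  by rewrite -x1 (bigD1 i)//= lerDl sumr_ge0.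
by rewrite ltrD2l ltr1n.
Qed.

End simplex_topology.

Section simplex_lift.
Context (R : realType) (Y X : topologicalType) (p : Y -> X).
Hypotheses (hausdorffY : hausdorff_space Y)
  (p_open : forall A, open A -> open (p @` A))
  (p_inj : forall y : Y, exists2 W : set Y, nbhs y W &
    forall a b, W a -> W b -> p a = p b -> a = b)
  (p_deck : forall y y', p y = p y' ->
    exists g : Y -> Y, [/\ continuous g, forall z, p (g z) = p z & g y = y'])
  (p_surj : forall x, exists y, p y = x).

Lemma simplex_lift n (s : @simplex R n -> X) (x0 : @simplex R n) (y0 : Y) :
  continuous s -> p y0 = s x0 -> exists l : @simplex R n -> Y,
    [/\ continuous l, forall x, p (l x) = s x & l x0 = y0].
Proof.
(* Radial lifting starts at the origin, which is not a point of the simplex. The retraction extends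
   s to the whole space, and the lift obtained there is restricted afterwards. *)
move=> sc py0; pose f := s \o @simplex_retract R n.
have fc : continuous f.
  by move=> x; apply: continuous_comp; [exact: simplex_retract_continuous | exact: sc].
have [C C0 CP] := simplex_bounded R n.
have [y1 py1] := p_surj (f 0).
have [l0 l00 l0P] := lift_ball hausdorffY p_open p_inj p_deck C0 fc (fun x => p_surj (f x)) py1.
pose l1 (x : @simplex R n) := l0 (set_val x).
have pl1 x : p (l1 x) = s x.
  by have [-> _] := l0P _ (CP x); rewrite /f /= simplex_retractK.
have l1c : continuous l1.
  move=> x; apply: continuous_comp; last by have [] := l0P _ (CP x).
  exact: (@initial_continuous _ _ set_val).
have [g [gc pg gy]] := p_deck (etrans (pl1 x0) (esym py0)).
exists (g \o l1); split => // x; last by rewrite /= pg.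
by apply: continuous_comp; [exact: l1c | exact: gc].
Qed.

Lemma simplex_lift_unique n (l l' : @simplex R n -> Y) (x0 : @simplex R n) :
  continuous l -> continuous l' -> (forall x, p (l x) = p (l' x)) ->
  l x0 = l' x0 -> forall x, l x = l' x.
Proof.
move=> lc l'c pll' ll'0 x.
(* Outside [0, 1] this affine path may leave the simplex; retracting it gives a path defined on the
   whole line, as [lift_unique] requires. *)
pose c (t : R) : 'rV[R]_n.+1 := set_val x0 + t *: (set_val x - set_val x0).
pose c' t := simplex_retract (c t).
have c0 : continuous c.
  apply: fun_addr_continuous; first exact: fun_cst_continuous.
  by apply: fun_scaler_continuous; [move=> ? | exact: fun_cst_continuous].
have cc : continuous c'.
  move=> t; apply: continuous_comp; first exact: c0.
  exact: simplex_retract_continuous.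
have : forall t : R, (l \o c') t = (l' \o c') t.
  apply: (lift_unique hausdorffY p_inj) => [t|t|t|] /=.
  - by apply: continuous_comp; [exact: cc | exact: lc].
  - by apply: continuous_comp; [exact: cc | exact: l'c].
  - exact: pll'.
  - by rewrite /c' /c scale0r addr0 simplex_retractK.
by move/(_ 1); rewrite /= /c' /c scale1r addrC subrK simplex_retractK.
Qed.

End simplex_lift.
(** * First homology of a quotient of a contractible space *)

Section free_groups.
Context (S : choiceType).

Lemma freeg_lift_ex (B : zmodType) (f : S -> B) :
  exists F : {freeg S / int} -> B,
    {morph F : x y / x - y} /\ forall s, F << s >> = f s.
Proof.
(* [zmodule B] is B seen as a module over the integers, the kind of target that [fglift] expects. *)
pose fz : S -> zmodule B := f.
exists (fglift fz); split=> [x y|s]; first exact: (lift_is_additive fz x y).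
by rewrite liftU scale1r.
Qed.

Lemma freeg_ext (B : zmodType) (F F' : {freeg S / int} -> B) :
  {morph F : x y / x - y} -> {morph F' : x y / x - y} ->
  (forall s, F << s >> = F' << s >>) -> F =1 F'.
Proof.
move=> Fadd F'add FF' c.
pose f : {additive {freeg S / int} -> B} :=
  HB.pack F (GRing.isZmodMorphism.Build _ _ F Fadd).
pose f' : {additive {freeg S / int} -> B} :=
  HB.pack F' (GRing.isZmodMorphism.Build _ _ F' F'add).
suff : f c = f' c by [].
rewrite -(freeg_sumE c) !raddf_sum; apply: eq_bigr => s _.
have -> : << coeff s c *g s >> = << s >> *~ coeff s c :> {freeg S / int}.
  by rewrite freegU_mulz intz.
by rewrite !raddfMz; congr (_ *~ _); exact: FF'.
Qed.

End free_groups.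

Section boundary_formulas.
Context (R : realType) (T : topologicalType).

Lemma boundary1E (s : singular_simplex R T 1) :
  boundary << s >> = << face ord0 s >> - << face (lift ord0 ord0) s >>.
Proof.
rewrite /boundary liftU scale1r !big_ord_recl big_ord0 addr0.
by rewrite expr0 scale1r expr1 scaleN1r.
Qed.

Lemma boundary2E (s : singular_simplex R T 2) :
  boundary << s >> = << face ord0 s >> - << face (lift ord0 ord0) s >>
    + << face (lift ord0 (lift ord0 ord0)) s >>.
Proof.
rewrite /boundary liftU scale1r !big_ord_recl big_ord0 addr0 addrA.
by rewrite expr0 scale1r expr1 scaleN1r -signr_odd scale1r.
Qed.

End boundary_formulas.

Section H1_elements.
Context (R : realType) (T : topologicalType).

Lemma H1_pi_eq (x y : cycles R T) :
  (\pi_(H1 R T) x = \pi_(H1 R T) y)%qT <->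
  exists d : chain R T 2, boundary d = val x - val y.
Proof.
have E : (x - y \in @is_boundary R T) = (x == y %[mod H1 R T])%qT.
  exact: Quotient.idealrBE.
split=> [/eqP|[d dxy]].
  by rewrite -E => /asboolP[d dE]; exists d; rewrite dE raddfB.
apply/eqP; rewrite -E; apply/asboolP; exists d.
by rewrite dxy raddfB.
Qed.

End H1_elements.

(** * Coordinates on the 1-simplex and on the faces of the 2-simplex *)

Section low_dimensional_simplices.
Context (R : realType).

Definition scoord n (j : 'I_n.+1) (x : @simplex R n) : R := set_val x ord0 j.

(** The point with barycentric coordinates (1 - r, r); the retraction gives it a meaning for every
    real r. *)
Definition seg (r : R) : @simplex R 1 :=
  simplex_retract (\row_j (if j == ord0 then 1 - r else r)).

Lemma seg_continuous : continuous seg.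
Proof.
pose f (r : R) : 'rV[R]_2 := \row_j (if j == ord0 then 1 - r else r).
suff fc : continuous f.
  move=> r; apply: (@continuous_comp _ _ _ f (@simplex_retract R 1)).
    exact: fc.
  exact: simplex_retract_continuous.
apply: rV_continuous => j; under eq_fun do rewrite mxE.
case: eqP => _; last by move=> ?.
by apply: fun_subr_continuous; [exact: fun_cst_continuous | move=> ?].
Qed.

Lemma scoord_sum1 (x : @simplex R 1) : scoord ord0 x = 1 - scoord ord_max x.
Proof.
have [_] := set_valP x; rewrite !big_ord_recl big_ord0 addr0 => <-.
by rewrite /scoord (_ : ord_max = lift ord0 ord0) ?addrK//; exact: val_inj.
Qed.

Lemma seg_scoord (x : @simplex R 1) : seg (scoord ord_max x) = x.
Proof.
rewrite -[RHS]simplex_retractK /seg; congr simplex_retract.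
apply/rowP => j; rewrite mxE; case: eqP => [->|j0].
  by rewrite -scoord_sum1.
suff -> : j = ord_max by [].
case: j j0 => -[|[|//]] ? j0; last exact: val_inj.
by case: j0; exact: val_inj.
Qed.

Lemma scoord_seg (r : R) : 0 <= r -> r <= 1 -> scoord ord_max (seg r) = r.
Proof.
move=> r0 r1; rewrite /scoord /= mxE.
have -> : possum (\row_(j < 2) (if j == ord0 then 1 - r else r)) = 1.
  rewrite /possum !big_ord_recl big_ord0 !mxE/= addr0.
  by rewrite !(elimT max_idPr) ?subr_ge0// subrK.
by rewrite maxxx subrr mul0rn addr0 divr1 mxE /= (elimT max_idPr).
Qed.

Let i1 : 'I_3 := lift ord0 ord0.
Let i2 : 'I_3 := lift ord0 (lift ord0 ord0).

Lemma coface0_1 (x : @simplex R 1) : scoord i1 (coface ord0 x) = 1 - scoord ord_max x.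
Proof.
by rewrite -scoord_sum1 /scoord /= mxE liftK.
Qed.

Lemma coface0_2 (x : @simplex R 1) : scoord i2 (coface ord0 x) = scoord ord_max x.
Proof.
rewrite /scoord /= mxE liftK.
by have -> : lift ord0 ord0 = ord_max :> 'I_2 by exact: val_inj.
Qed.

Lemma coface1_1 (x : @simplex R 1) : scoord i1 (coface i1 x) = 0.
Proof. by rewrite /scoord /= mxE unlift_none. Qed.

Lemma coface1_2 (x : @simplex R 1) : scoord i2 (coface i1 x) = scoord ord_max x.
Proof.
have -> : i2 = lift i1 ord_max by exact: val_inj.
by rewrite /scoord /= mxE liftK.
Qed.

Lemma coface2_1 (x : @simplex R 1) : scoord i1 (coface i2 x) = scoord ord_max x.
Proof.
have -> : i1 = lift i2 ord_max by exact: val_inj.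
by rewrite /scoord /= mxE liftK.
Qed.

Lemma coface2_2 (x : @simplex R 1) : scoord i2 (coface i2 x) = 0.
Proof. by rewrite /scoord /= mxE unlift_none. Qed.

Lemma simplex2_eq (x y : @simplex R 2) :
  scoord i1 x = scoord i1 y -> scoord i2 x = scoord i2 y -> x = y.
Proof.
move=> e1 e2; apply: val_inj; apply/rowP => j.
have sum1 (z : @simplex R 2) : scoord ord0 z = 1 - scoord i1 z - scoord i2 z.
  have [_] := set_valP z; rewrite !big_ord_recl big_ord0 addr0 => <-.
  by rewrite -addrA -opprD addrK.
have [->|[->|->]] : j = ord0 \/ j = i1 \/ j = i2.
  case: j => -[|[|[|//]]] h; [left|right; left|right; right]; exact: val_inj.
- by have := sum1 x; rewrite e1 e2 -sum1.
- exact: e1.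
- exact: e2.
Qed.

Lemma coface0_seg0 : coface ord0 (seg 0) = coface i2 (seg 1).
Proof.
by apply: simplex2_eq; rewrite ?coface0_1 ?coface0_2 ?coface2_1 ?coface2_2 !scoord_seg// subr0.
Qed.

Lemma coface0_seg1 : coface ord0 (seg 1) = coface i1 (seg 1).
Proof.
by apply: simplex2_eq; rewrite ?coface0_1 ?coface0_2 ?coface1_1 ?coface1_2 !scoord_seg// subrr.
Qed.

Lemma coface1_seg0 : coface i1 (seg 0) = coface i2 (seg 0).
Proof.
by apply: simplex2_eq; rewrite ?coface1_1 ?coface1_2 ?coface2_1 ?coface2_2 !scoord_seg.
Qed.

Lemma coface_point0 (x : @simplex R 0) : coface ord0 x = seg 1.
Proof.
rewrite -[LHS]seg_scoord; congr seg.
have -> : ord_max = lift ord0 ord0 :> 'I_2 by exact: val_inj.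
rewrite /scoord /= mxE liftK.
by have [_] := set_valP x; rewrite big_ord_recl big_ord0 addr0.
Qed.

Lemma coface_point1 (x : @simplex R 0) : coface (lift ord0 ord0) x = seg 0.
Proof.
rewrite -[LHS]seg_scoord; congr seg.
have -> : ord_max = lift ord0 ord0 :> 'I_2 by exact: val_inj.
by rewrite /scoord /= mxE unlift_none.
Qed.

End low_dimensional_simplices.
Section H1_of_quotient.
Context (R : realType) (Y X : topologicalType) (p : Y -> X).
Hypotheses (hausdorffY : hausdorff_space Y) (p_cont : continuous p)
  (p_open : forall A, open A -> open (p @` A))
  (p_inj : forall y : Y, exists2 W : set Y, nbhs y W &
    forall a b, W a -> W b -> p a = p b -> a = b)
  (p_surj : forall x, exists y, p y = x).
Context (G : Type) (mul : G -> G -> G) (act : G -> Y -> Y).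
Hypotheses (act_cont : forall g, continuous (act g))
  (act_mul : forall g h y, act (mul g h) y = act g (act h y))
  (act_free : forall g h y, act g y = act h y -> g = h)
  (p_act : forall g y, p (act g y) = p y)
  (p_orbit : forall y y', p y = p y' -> exists g, act g y = y').
(* [mix t a b] plays the role of [(1 - t) a + t b]. *)
Context (mix : R -> Y -> Y -> Y).
Hypotheses (mix0 : forall a b, mix 0 a b = a) (mix1 : forall a b, mix 1 a b = b)
  (mixxx : forall t a, mix t a a = a)
  (mix_act : forall g t a b, act g (mix t a b) = mix t (act g a) (act g b))
  (mix_cont : forall (T : topologicalType) (t : T -> R) (a b : T -> Y),
    continuous t -> continuous a -> continuous b ->
    continuous (fun x => mix (t x) (a x) (b x))).
Context (B : zmodType) (chi : G -> B).
Hypotheses (chi_mul : forall g h, chi (mul g h) = chi g + chi h)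
  (chi_surj : forall b, exists g, chi g = b)
  (* [chi] is the abelianization of [G]. *)
  (chi_ker : forall (M : zmodType) (psi : G -> M),
    (forall g h, psi (mul g h) = psi g + psi h) ->
    forall g, chi g = 0 -> psi g = 0).

Local Notation sing n := (@simplex R n -> Y).

Let i1 : 'I_3 := lift ord0 ord0.
Let i2 : 'I_3 := lift ord0 (lift ord0 ord0).

Let p_deck y y' : p y = p y' ->
  exists g : Y -> Y, [/\ continuous g, forall z, p (g z) = p z & g y = y'].
Proof. by move=> /p_orbit[g gy]; exists (act g); split. Qed.

Let push_cont n (s : sing n) (sc : continuous s) : continuous (p \o s).
Proof. by move=> x; apply: continuous_comp; [exact: sc | exact: p_cont]. Qed.

Definition push n (s : sing n) (sc : continuous s) : singular_simplex R X n :=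
  mkcts (push_cont sc).

(** Boundaries are divided out of all 1-chains, and not only out of the cycles as in [H1]: the paths
    into which a cycle is cut are not closed, yet they need classes. *)
Definition is_bounding : {pred chain R X 1} :=
  [pred c : chain R X 1 | `[< exists d : chain R X 2, boundary d = c >]].

Lemma is_bounding_zmod_closed : zmod_closed is_bounding.
Proof.
split=> [|x y].
  by apply/asboolP; exists 0; rewrite -(subrr 0) boundaryB subrr.
move=> /asboolP[c cx] /asboolP[d dy]; apply/asboolP.
by exists (c - d); rewrite boundaryB cx dy.
Qed.

HB.instance Definition _ :=
  GRing.isZmodClosed.Build (chain R X 1) is_bounding is_bounding_zmod_closed.

Definition chains_mod_boundaries : zmodType := Quotient.quot is_bounding.
Local Notation M := chains_mod_boundaries.

Definition chain_class (c : chain R X 1) : M := (\pi_M c)%qT.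

Lemma chain_classB : {morph chain_class : x y / x - y}.
Proof. by move=> x y; rewrite /chain_class raddfB. Qed.

Lemma chain_classD : {morph chain_class : x y / x + y}.
Proof. by move=> x y; rewrite /chain_class raddfD. Qed.

Lemma chain_class_eq0 c :
  chain_class c = 0 <-> exists d : chain R X 2, boundary d = c.
Proof.
have E : (c - 0 \in is_bounding) = (c == 0 %[mod M])%qT.
  exact: Quotient.idealrBE.
rewrite /chain_class; split=> [c0|[d dc]].
  have : c - 0 \in is_bounding by rewrite E c0 raddf0.
  by rewrite subr0 => /asboolP.
have : c - 0 \in is_bounding by rewrite subr0; apply/asboolP; exists d.
by rewrite E raddf0 => /eqP.
Qed.

Definition cl (s : sing 1) (sc : continuous s) : M := chain_class << push sc >>.

Lemma cl_triangle (t : sing 2) (s0 s1 s2 : sing 1) (tc : continuous t)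
    (c0 : continuous s0) (c1 : continuous s1) (c2 : continuous s2) :
  (forall x, s0 x = t (coface ord0 x)) ->
  (forall x, s1 x = t (coface i1 x)) ->
  (forall x, s2 x = t (coface i2 x)) ->
  cl c1 = cl c0 + cl c2.
Proof.
move=> e0 e1 e2; apply/eqP; rewrite eq_sym -subr_eq0; apply/eqP.
rewrite /cl -chain_classD -chain_classB; apply/chain_class_eq0.
exists << push tc >>; rewrite boundary2E addrAC.
congr (_ + _ - _); congr (<< _ >>); apply/continuousEP => x /=; congr p.
- by rewrite e0.
- by rewrite e2.
- by rewrite e1.
Qed.

Lemma cl_ext (s s' : sing 1) (sc : continuous s) (sc' : continuous s') :
  (forall x, p (s x) = p (s' x)) -> cl sc = cl sc'.
Proof.
by move=> ss'; rewrite /cl; congr (chain_class << _ >>); apply/continuousEP.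
Qed.

(** A constant 2-simplex has three equal faces, so the class c satisfies c = c + c. *)
Lemma cl_cst y : cl (@fun_cst_continuous (@simplex R 1) Y y) = 0.
Proof.
have E := @cl_triangle _ _ _ _ (@fun_cst_continuous (@simplex R 2) Y y)
  (@fun_cst_continuous (@simplex R 1) Y y) (@fun_cst_continuous (@simplex R 1) Y y)
  (@fun_cst_continuous (@simplex R 1) Y y) (fun=> erefl) (fun=> erefl) (fun=> erefl).
by apply: (addrI (cl (@fun_cst_continuous (@simplex R 1) Y y))); rewrite -E addr0.
Qed.

Let scoordc n (j : 'I_n.+1) : continuous (@scoord R n j).
Proof. exact: coord_continuous_simplex. Qed.

Let scoordDc n (i j : 'I_n.+1) : continuous (fun x : @simplex R n => scoord i x + scoord j x).
Proof. by apply: fun_addr_continuous; exact: scoordc. Qed.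

Let comp_cont (T U V : topologicalType) (f : T -> U) (g : U -> V) :
  continuous f -> continuous g -> continuous (fun x => g (f x)).
Proof. by move=> fc gc x; apply: continuous_comp; [exact: fc | exact: gc]. Qed.

(* The straight-line homotopy on the square, cut along its diagonal: the two
   triangles share the diagonal, and the homotopy is constant on the vertical sides. *)
Lemma cl_homotopy (s s' : sing 1) (sc : continuous s) (sc' : continuous s') :
  s (seg 0) = s' (seg 0) -> s (seg 1) = s' (seg 1) -> cl sc = cl sc'.
Proof.
move=> e0 e1.
pose t1 (x : @simplex R 2) := mix (scoord i2 x)
  (s (seg (scoord i1 x + scoord i2 x))) (s' (seg (scoord i1 x + scoord i2 x))).
pose t2 (x : @simplex R 2) := mix (scoord i1 x + scoord i2 x)
  (s (seg (scoord i2 x))) (s' (seg (scoord i2 x))).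
pose diag (x : @simplex R 1) := mix (scoord ord_max x) (s x) (s' x).
have t1c : continuous t1.
  apply: mix_cont; first exact: scoordc.
    exact: (comp_cont (comp_cont (@scoordDc _ i1 i2) (@seg_continuous R)) sc).
  exact: (comp_cont (comp_cont (@scoordDc _ i1 i2) (@seg_continuous R)) sc').
have t2c : continuous t2.
  apply: mix_cont; first exact: scoordDc.
    exact: (comp_cont (comp_cont (@scoordc _ i2) (@seg_continuous R)) sc).
  exact: (comp_cont (comp_cont (@scoordc _ i2) (@seg_continuous R)) sc').
have dc : continuous diag by apply: mix_cont; [exact: scoordc | exact: sc | exact: sc'].
have E1 : cl dc = cl (@fun_cst_continuous (@simplex R 1) Y (s (seg 1))) + cl sc.
  apply: (cl_triangle t1c) => x; rewrite /t1.
  - by rewrite coface0_1 coface0_2 subrK -e1 mixxx.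
  - by rewrite coface1_1 coface1_2 add0r seg_scoord.
  - by rewrite coface2_1 coface2_2 addr0 seg_scoord mix0.
have E2 : cl dc = cl sc' + cl (@fun_cst_continuous (@simplex R 1) Y (s (seg 0))).
  apply: (cl_triangle t2c) => x; rewrite /t2.
  - by rewrite coface0_1 coface0_2 subrK mix1 seg_scoord.
  - by rewrite coface1_1 coface1_2 add0r seg_scoord.
  - by rewrite coface2_1 coface2_2 addr0 -e0 mixxx.
by move: E1; rewrite E2 !cl_cst addr0 add0r.
Qed.

Definition line (a b : Y) (x : @simplex R 1) : Y := mix (scoord ord_max x) a b.

Lemma line_continuous a b : continuous (line a b).
Proof.
by apply: mix_cont; [exact: scoordc | exact: fun_cst_continuous..].
Qed.

Definition cl_line a b : M := cl (@line_continuous a b).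

Lemma line0 a b : line a b (seg 0) = a.
Proof. by rewrite /line scoord_seg// mix0. Qed.

Lemma line1 a b : line a b (seg 1) = b.
Proof. by rewrite /line scoord_seg// mix1. Qed.

Lemma cl_endpoints (s : sing 1) (sc : continuous s) :
  cl sc = cl_line (s (seg 0)) (s (seg 1)).
Proof. by apply: cl_homotopy; rewrite ?line0 ?line1. Qed.

Lemma cl_lineD a b c : cl_line a b + cl_line b c = cl_line a c.
Proof.
pose t (x : @simplex R 2) := mix (scoord i2 x) (mix (scoord i1 x) a b) c.
have tc : continuous t.
  apply: mix_cont; [exact: scoordc | | exact: fun_cst_continuous].
  by apply: mix_cont; [exact: scoordc | exact: fun_cst_continuous..].
(* The face of [t] opposite to a. As [mix] is not assumed associative, this face need not be the
   segment from b to c; it is only a path with these end points, which is enough by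
   [cl_endpoints]. *)
pose t0 (x : @simplex R 1) := mix (scoord ord_max x) (mix (1 - scoord ord_max x) a b) c.
have t0c : continuous t0.
  apply: mix_cont; [exact: scoordc | | exact: fun_cst_continuous].
  apply: mix_cont; [| exact: fun_cst_continuous..].
  by apply: fun_subr_continuous; [exact: fun_cst_continuous | exact: scoordc].
have E : cl_line a c = cl t0c + cl_line a b.
  apply: (cl_triangle tc) => x; rewrite /t /line /t0.
  - by rewrite coface0_1 coface0_2.
  - by rewrite coface1_1 coface1_2 mix0.
  - by rewrite coface2_1 coface2_2 mix0.
rewrite E addrC; congr (_ + _); rewrite cl_endpoints /t0 !scoord_seg//.
by rewrite subr0 mix0 !mix1.
Qed.

Lemma cl_line_act g a b : cl_line (act g a) (act g b) = cl_line a b.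
Proof. by apply: cl_ext => x; rewrite /line -mix_act p_act. Qed.

Lemma cl_line_sym a b : cl_line a b = - cl_line b a.
Proof.
apply/eqP; rewrite -addr_eq0 cl_lineD; apply/eqP.
by apply: (addrI (cl_line a a)); rewrite cl_lineD addr0.
Qed.

Context (y0 : Y).

Definition loop_class (g : G) : M := cl_line y0 (act g y0).

(** Go from y0 to g y0 and on to gh y0: the second segment is the g-translate of the one from y0 to
    h y0, hence has the same image in X. *)
Lemma loop_class_mul g h : loop_class (mul g h) = loop_class g + loop_class h.
Proof. by rewrite /loop_class act_mul -(cl_lineD y0 (act g y0)) cl_line_act. Qed.

(** [chi_ker] speaks of the kernel only, and the interface of G has no inverses. Multiplying both
    elements by some k with [chi k = - chi h] brings them into the kernel, and the class of k
    cancels in M. *)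
Lemma loop_class_eq g h : chi g = chi h -> loop_class g = loop_class h.
Proof.
move=> gh; have [k kP] := chi_surj (- chi h).
have E f : chi f = chi h -> loop_class (mul f k) = 0.
  move=> fh; apply: (chi_ker loop_class_mul).
  by rewrite chi_mul kP fh subrr.
apply: (addIr (loop_class k)).
by rewrite -!loop_class_mul !E.
Qed.

Definition sec (x : X) : Y := projT1 (cid (p_surj x)).

Lemma secK x : p (sec x) = x.
Proof. exact: projT2 (cid (p_surj x)). Qed.

Lemma monodromy_ex (s : singular_simplex R X 1) : exists g, exists l : sing 1,
  [/\ continuous l, forall x, p (l x) = s x, l (seg 0) = sec (s (seg 0)) &
      l (seg 1) = act g (sec (s (seg 1)))].
Proof.
have [l [lc pl l0]] := simplex_lift hausdorffY p_open p_inj p_deck p_surj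
  (@cts_fun _ _ s) (secK (s (seg 0))).
have [g gE] := p_orbit (etrans (secK _) (esym (pl (seg 1)))).
by exists g, l.
Qed.

Definition monodromy (s : singular_simplex R X 1) : G := projT1 (cid (monodromy_ex s)).

(** By uniqueness of lifts, [l] is the h-translate of the lift that defines the monodromy, so the
    two end at the same point. Freeness of the action turns this into an equality in G. *)
Lemma chi_monodromy (s : singular_simplex R X 1) (l : sing 1) g h :
  continuous l -> (forall x, p (l x) = s x) ->
  l (seg 0) = act h (sec (s (seg 0))) -> l (seg 1) = act g (sec (s (seg 1))) ->
  chi g = chi h + chi (monodromy s).
Proof.
move=> lc pl l0 l1; rewrite /monodromy; case: cid => k [l' [l'c pl' l'0 l'1]] /=.
rewrite -chi_mul; congr chi.
apply: (@act_free _ _ (sec (s (seg 1)))); rewrite act_mul -l1 -l'1.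
apply: (@simplex_lift_unique _ _ _ p hausdorffY p_inj 1 l (act h \o l') (seg 0)) => //.
- by move=> x; apply: continuous_comp; [exact: l'c | exact: act_cont].
- by move=> x; rewrite /= p_act pl'.
- by rewrite /= l'0.
Qed.

(** Lift t to l and write the lift of each vertex v as g(v) applied to the chosen lift of t(v). On
    every face, the image of the monodromy under chi is the difference of chi(g) between the two end
    vertices, and the three differences telescope. *)
Lemma chi_monodromy_face (t : singular_simplex R X 2) :
  chi (monodromy (face i1 t)) =
  chi (monodromy (face ord0 t)) + chi (monodromy (face i2 t)).
Proof.
pose v0 : @simplex R 2 := coface i2 (seg 0).
have [l [lc pl l0]] := simplex_lift hausdorffY p_open p_inj p_deck p_surj
  (@cts_fun _ _ t) (secK (t v0)).
have lf i : continuous (l \o coface i).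
  by move=> x; apply: continuous_comp; [exact: coface_continuous | exact: lc].
have ex v : exists g, act g (sec (t v)) = l v.
  by apply: p_orbit; rewrite secK pl.
have [g gP] := choice ex.
have F i : chi (g (coface i (seg 1))) =
    chi (g (coface i (seg 0))) + chi (monodromy (face i t)).
  apply: (chi_monodromy (lf i)) => [x|/=|/=]; rewrite ?pl//.
have := F ord0; have := F i1; have := F i2.
rewrite coface1_seg0 coface0_seg1 coface0_seg0 => E2 E1 E0.
apply: (addrI (chi (g (coface i2 (seg 0))))).
by rewrite -E1 E0 E2 -addrA [_ + chi (monodromy (face ord0 t))]addrC.
Qed.

Theorem H1_quotient_iso : exists Phi : H1 R X -> B,
  [/\ {morph Phi : x y / x - y}, injective Phi & forall b, exists x, Phi x = b].
Proof.
have [Phi0 [Phi0B Phi0E]] := freeg_lift_ex (fun s => chi (monodromy s)).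
have Phi0D : {morph Phi0 : x y / x + y}.
  by move=> x y; rewrite -{2}(addrK y x) Phi0B subrK.
have bd0 d : Phi0 (boundary d) = 0.
  pose F (d : chain R X 2) := Phi0 (boundary d).
  suff : F =1 (fun=> 0) by move=> /(_ d).
  apply: freeg_ext => [x y|x y|t]; rewrite ?subr0//.
    by rewrite /F boundaryB Phi0B.
  by rewrite /F boundary2E Phi0D Phi0B !Phi0E chi_monodromy_face opprD addNKr addNr.
pose Phi (x : H1 R X) := Phi0 (val (repr x)).
have PhiE (c : cycles R X) : Phi (\pi_(H1 R X) c)%qT = Phi0 (val c).
  rewrite /Phi; have [d dE] := iffLR (H1_pi_eq (repr (\pi_(H1 R X) c)%qT) c) (reprK _).
  by apply/eqP; rewrite -subr_eq0 -Phi0B -dE bd0.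
have [psi psiP] : exists psi : B -> M, forall g, psi (chi g) = loop_class g.
  have [g gP] := choice chi_surj.
  by exists (fun b => loop_class (g b)) => h; apply: loop_class_eq; rewrite gP.
have psiB : {morph psi : x y / x - y}.
  move=> x y; apply/eqP; rewrite eq_sym subr_eq; apply/eqP.
  have [g gE] := chi_surj (x - y); have [h hE] := chi_surj y.
  by rewrite -gE -hE !psiP -loop_class_mul -psiP chi_mul gE hE subrK.
have [kappa [kappaB kappaE]] :=
  freeg_lift_ex (fun v : singular_simplex R X 0 => cl_line y0 (sec (v (simplex_retract 0)))).
(* [kappa] collects the segments from y0 to the chosen lifts of the end points. It depends on the
   boundary only and so vanishes on cycles; there the class is determined by [Phi0 c], which yields
   injectivity. *)
have key (c : chain R X 1) : chain_class c = psi (Phi0 c) + kappa (boundary c).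
  pose F (c : chain R X 1) := psi (Phi0 c) + kappa (boundary c).
  suff : @chain_class =1 F by exact.
  apply: freeg_ext => [x y|x y|s]; first exact: chain_classB.
    by rewrite /F Phi0B psiB boundaryB kappaB opprD addrACA.
  rewrite /F Phi0E psiP boundary1E kappaB !kappaE.
  rewrite /= coface_point0 coface_point1.
  rewrite /loop_class /monodromy; case: cid => g [l [lc pl l0 l1]] /=.
  have -> : chain_class << s >> = cl lc.
    by rewrite /cl; congr (chain_class << _ >>); apply/continuousEP => x /=; exact/esym/pl.
  rewrite cl_endpoints l0 l1 -(cl_line_act g y0 (sec (s (seg 1)))) -cl_line_sym.
  by rewrite addrA cl_lineD addrC cl_lineD.
exists Phi; split.
- move=> x y; rewrite -[x]reprK -[y]reprK -raddfB !PhiE.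
  by rewrite raddfB Phi0B.
- move=> x y xy; rewrite -[x]reprK -[y]reprK; apply/H1_pi_eq.
  apply/chain_class_eq0; rewrite key Phi0B.
  rewrite -/(Phi x) -/(Phi y) xy subrr -(subrr 0) psiB subrr add0r.
  have [/eqP bx] := valP (repr x); have [/eqP by_] := valP (repr y).
  by rewrite boundaryB bx by_ subrr -(subrr 0) kappaB subrr.
- move=> b; have [g gE] := chi_surj b.
  have lc := @line_continuous y0 (act g y0).
  have cyc : << push lc >> \in @is_cycle R X.
    rewrite inE boundary1E subr_eq0; apply/eqP; congr (<< _ >>).
    apply/continuousEP => x; rewrite /= coface_point0 coface_point1.
    rewrite -[LHS]/(p (line y0 (act g y0) (seg 1))) -[RHS]/(p (line y0 (act g y0) (seg 0))).
    by rewrite line0 line1 p_act.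
  exists (\pi_(H1 R X) (exist (fun c => c \in @is_cycle R X) _ cyc : cycles R X))%qT.
  rewrite PhiE /= Phi0E -gE.
  (* The base point y0 need not be the chosen lift of its image; it is the h-translate of that lift.
     The segment thus runs from the translate by h to the translate by gh, and chi(h) cancels. *)
  have [h hE] := p_orbit (secK (p y0)).
  apply: (addrI (chi h)); rewrite -(@chi_monodromy _ _ (mul g h) h lc) => [|x||].
  - by rewrite chi_mul addrC.
  - by [].
  - by rewrite -[push lc (seg 0)]/(p (line y0 (act g y0) (seg 0))) !line0 hE.
  - rewrite -[push lc (seg 1)]/(p (line y0 (act g y0) (seg 1))) !line1.
    by rewrite p_act act_mul hE.
Qed.

End H1_of_quotient.
(** * Cubic fields with one complex place *)

Section embedding_of_root.
Context (K : fieldExtType rat) (C : numFieldType).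
Context (theta : K) (q : {poly rat}).
Hypotheses (theta_gen : <<1; theta>>%VS = {:K}%VS)
  (qE : map_poly (GRing.in_alg K) q = minPoly 1%VS theta).

Let E (p : {poly rat}) : K := (map_poly (GRing.in_alg K) p).[theta].

Lemma eval_gen_surj x : exists p, E p = x.
Proof.
have [|p pE] := @polyOver1P _ _ (Fadjoin_poly 1 theta x) _.
  exact: Fadjoin_polyOver.
by exists p; rewrite /E -pE Fadjoin_poly_eq// theta_gen memvf.
Qed.

Lemma eval_gen_dvd p : E p = 0 -> q %| p.
Proof.
move=> Ep; rewrite -(dvdp_map (GRing.in_alg K)) qE; apply: minPoly_dvdp.
  by apply/polyOver1P; exists p.
exact/rootP.
Qed.

(** K is the quotient of the rational polynomials by q, so evaluation at z descends to K. Each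
    element gets a chosen polynomial representing it, and [wd] makes the choice immaterial. *)
Lemma rmorph_of_root (z : C) : root (map_poly ratr q) z ->
  exists tau : {rmorphism K -> C}, tau theta = z.
Proof.
move=> qz; pose F (p : {poly rat}) : C := (map_poly ratr p).[z].
have EB p p' : E (p - p') = E p - E p' by rewrite /E rmorphB hornerD hornerN.
have EM p p' : E (p * p') = E p * E p' by rewrite /E rmorphM hornerM.
have FB p p' : F (p - p') = F p - F p' by rewrite /F rmorphB hornerD hornerN.
have FM p p' : F (p * p') = F p * F p' by rewrite /F rmorphM hornerM.
have wd p p' : E p = E p' -> F p = F p'.
  move=> pp'; apply/eqP; rewrite -subr_eq0 -FB; apply/eqP.
  have /dvdpP[r ->] : q %| p - p' by apply: eval_gen_dvd; rewrite EB pp' subrr.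
  by rewrite FM [F q](rootP qz) mulr0.
have [P PE] := choice eval_gen_surj.
pose tau x := F (P x).
have tauB : zmod_morphism tau.
  by move=> x y; rewrite /tau -FB; apply: wd; rewrite EB !PE.
have tauM : monoid_morphism tau.
  split=> [|x y]; last by rewrite /tau -FM; apply: wd; rewrite EM !PE.
  have <- : F 1 = 1 by rewrite /F rmorph1 hornerC.
  by apply: wd; rewrite PE /E rmorph1 hornerC.
pose rtau : {rmorphism K -> C} := HB.pack tau
  (GRing.isZmodMorphism.Build _ _ tau tauB) (GRing.isMonoidMorphism.Build _ _ tau tauM).
exists rtau; rewrite /rtau /= /tau.
have <- : F 'X = z by rewrite /F map_polyX hornerX.
by apply: wd; rewrite PE /E map_polyX hornerX.
Qed.

End embedding_of_root.

Lemma primitive_generator (K : fieldExtType rat) :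
  exists theta : K, <<1; theta>>%VS = {:K}%VS.
Proof.
exists (separable_generator 1 {:K}); symmetry.
apply: eq_adjoin_separable_generator; last exact: sub1v.
apply/separableP => x _; apply: pcharf0_separable.
exact: ftrans (pchar_lalg K) (pchar_num _).
Qed.

Section cubic_embeddings.
Context (K : fieldExtType rat) (R : realType) (sigma : embeddings K R 1 1).

Definition sigma1 : {rmorphism K -> R} := esigma_re sigma ord0.
Definition sigma2 : {rmorphism K -> R[i]} := esigma_im sigma ord0.

Definition tau (j : 'I_3) : {rmorphism K -> R[i]} :=
  match val j with
  | 0 => real_complex R \o sigma1
  | 1 => sigma2
  | _ => @conjc R \o sigma2
  end%N.

Lemma tau_ord0 x : tau ord0 x = (sigma1 x)%:C%C.
Proof. by []. Qed.

Lemma tau_ord1 x : tau (lift ord0 ord0) x = sigma2 x.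
Proof. by []. Qed.

Lemma tau_ord2 x : tau ord_max x = conjc (sigma2 x).
Proof. by []. Qed.

Lemma ord3P (j : 'I_3) : [\/ j = ord0, j = lift ord0 ord0 | j = ord_max].
Proof.
case: j => -[|[|[|//]]] h.
- by apply: Or31; exact: val_inj.
- by apply: Or32; exact: val_inj.
- by apply: Or33; exact: val_inj.
Qed.

(** The norm of x over the rationals; the two conjugate embeddings together contribute the squared
    modulus. *)
Lemma prod_tau x : \prod_j tau j x = (sigma1 x * Normc.normc (sigma2 x) ^+ 2)%:C%C.
Proof.
rewrite !big_ord_recl big_ord0 mulr1 tau_ord0 tau_ord1.
rewrite (_ : lift _ _ = ord_max) ?tau_ord2; last exact: val_inj.
case: (sigma2 x) => a b; apply/eqP; rewrite eq_complex /= sqr_sqrtr ?addr_ge0 ?sqr_ge0//.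
by apply/andP; split; apply/eqP; ring.
Qed.

Lemma tau_complete (t : {rmorphism K -> R[i]}) : exists j, t =1 tau j.
Proof.
have [nt|rt] := pselect (nonreal t).
  have [j [[E|E] _]] := esigma_imP sigma nt; rewrite (ord1 j) in E.
    by exists (lift ord0 ord0) => x; rewrite E.
  by exists ord_max => x; rewrite E.
have tE x : t x = (complex.Re (t x))%:C%C.
  apply/eqP; rewrite eq_complex /= eqxx /=.
  by apply/eqP; apply: contrapT => /eqP tx; apply: rt; exists x.
pose r x := complex.Re (t x).
have rB : zmod_morphism r by move=> x y; rewrite /r rmorphB raddfB.
have rM : monoid_morphism r.
  split=> [|x y]; first by rewrite /r rmorph1.
  by rewrite /r rmorphM {1}(tE x) {1}(tE y) /= mulr0 subr0.
pose rr : {rmorphism K -> R} := HB.pack r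
  (GRing.isZmodMorphism.Build _ _ r rB) (GRing.isMonoidMorphism.Build _ _ r rM).
have [j [E _]] := esigma_reP sigma rr; rewrite (ord1 j) in E.
by exists ord0 => x; rewrite tE tau_ord0 -[sigma1 x]E.
Qed.

Lemma tau_ext_inj i j : tau i =1 tau j -> i = j.
Proof.
(* A single element separates all three embeddings: its first image is real, and the other two are
   distinct complex conjugates. *)
have [x xI] := esigma_im_nonreal sigma ord0.
have n01 : tau ord0 x <> sigma2 x.
  by rewrite tau_ord0 /sigma2 => E; rewrite -E eqxx in xI.
have n02 : tau ord0 x <> conjc (sigma2 x).
  rewrite tau_ord0 /sigma2 => E; move: xI.
  by rewrite -[X in complex.Im X]conjcK -E /= oppr0 eqxx.
have n12 : sigma2 x <> conjc (sigma2 x).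
  rewrite /sigma2; move: xI; case: (esigma_im _ _ _) => a b /= b0 [] /eqP.
  by rewrite -addr_eq0 -mulr2n mulrn_eq0 /= (negPf b0).
have /[swap] /(_ x) : forall i j, tau i x = tau j x -> i = j.
  move=> {}i {}j; case: (ord3P i) => ->; case: (ord3P j) => ->;
    rewrite ?tau_ord1 ?tau_ord2 => // /esym; by [|move/n01|move/n02|move/n12|move/esym/n01|move/esym/n02|move/esym/n12].
by move=> E; apply.
Qed.

Section generator.
Context (theta : K) (q : {poly rat}).
Hypotheses (theta_gen : <<1; theta>>%VS = {:K}%VS)
  (qE : map_poly (GRing.in_alg K) q = minPoly 1%VS theta).

Lemma tau_horner j p :
  tau j (map_poly (GRing.in_alg K) p).[theta] = (map_poly ratr p).[tau j theta].
Proof.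
rewrite -horner_map -map_poly_comp; congr (_.[_]); apply: eq_map_poly => c.
exact: (fmorph_eq_rat (tau j \o GRing.in_alg K)).
Qed.

Lemma tau_gen_inj : injective (fun j => tau j theta).
Proof.
move=> i j ij; apply: tau_ext_inj => x.
by have [p <-] := eval_gen_surj theta_gen x; rewrite !tau_horner ij.
Qed.

(** Both sides are monic with simple roots, so comparing root sets suffices: a root of q defines an
    embedding of K, and every embedding is some [tau j]. *)
Lemma minPoly_conjugates :
  map_poly ratr q = \prod_j ('X - (tau j theta)%:P) :> {poly R[i]}.
Proof.
have q_monic : q \is monic.
  by rewrite -(map_monic (GRing.in_alg K)) qE monic_minPoly.
have [rs rsE] := closed_field_poly_normal (map_poly ratr q : {poly R[i]}).
rewrite lead_coef_map (monicP q_monic) rmorph1 scale1r in rsE.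
have rs_uniq : uniq rs.
  rewrite -separable_prod_XsubC -rsE separable_map -(separable_map (GRing.in_alg K)) qE.
  by apply: pcharf0_separable; exact: ftrans (pchar_lalg K) (pchar_num _).
have -> : \prod_j ('X - (tau j theta)%:P) =
    \prod_(z <- codom (fun j => tau j theta)) ('X - z%:P) :> {poly R[i]}.
  by rewrite /codom /image_mem big_map big_enum.
rewrite rsE.
apply/perm_big/uniq_perm => // [|z].
  by rewrite map_inj_uniq ?enum_uniq//; exact: tau_gen_inj.
rewrite -root_prod_XsubC -rsE; apply/idP/codomP => [/(rmorph_of_root theta_gen qE)|[j ->]].
  by move=> [t <-]; have [j ->] := tau_complete t; exists j.
apply/rootP; rewrite -tau_horner qE.
by have /rootP -> := root_minPoly 1 theta; rewrite rmorph0.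
Qed.

End generator.

(** The degree is not part of the data; it is found by counting the conjugates of a primitive
    element, one for each embedding. *)
Lemma dim_cubic : \dim {:K} = 3%N.
Proof.
have [theta gen] := primitive_generator K.
have /polyOver1P[q qE] := minPolyOver 1 theta.
have : size (map_poly ratr q : {poly R[i]}) = 4%N.
  by rewrite (minPoly_conjugates gen (esym qE)) size_prod_XsubC /index_enum -enumT size_enum_ord.
rewrite size_map_poly -(size_map_poly (GRing.in_alg K)) -qE size_minPoly => /succn_inj dE.
by rewrite -gen dim_Fadjoin dE dimv1.
Qed.

End cubic_embeddings.

(** * Integrality, lattices, and an integral basis of the cubic field *)

Lemma rat_integral_int (C : numFieldType) (q : rat) :
  integralOver (intr : int -> C) (ratr q) -> exists m : int, q = m%:~R.
Proof.
move=> [p p_monic]; rewrite (_ : map_poly intr p = map_poly ratr (map_poly intr p : {poly rat})).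
  rewrite fmorph_root => pq.
  (* The root is moved to [algC], where a rational algebraic integer is known to be an integer. *)
  have /intrP[m mE] : (ratr q : algC) \is a Num.int.
    apply: Cint_rat_Aint; first exact: Crat_rat.
    apply: (@root_monic_Aint (map_poly intr p)).
    - rewrite -(fmorph_root (ratr : {rmorphism rat -> algC})) -map_poly_comp in pq.
      rewrite (eq_map_poly (g := intr)) // in pq => z.
      by rewrite /= ratr_int.
    - by rewrite monic_map.
    - by apply/polyOverP => i; rewrite coef_map /= intr_int.
  by exists m; apply: (fmorph_inj (ratr : {rmorphism rat -> algC})); rewrite /= mE ratr_int.
by rewrite -map_poly_comp; apply: eq_map_poly => z; rewrite /= ratr_int.
Qed.

(* Among the bases of sublattices of full rank choose one with determinant of least
   absolute value: reducing a coordinate modulo the determinant yields a row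
   replacement with smaller determinant, which must vanish. *)
Lemma lattice_basis n (H : 'rV[int]_n -> Prop) (B0 : 'M[int]_n) :
  (forall x y, H x -> H y -> H (x - y)) ->
  \det B0 != 0 -> (forall i, H (row i B0)) ->
  exists B : 'M[int]_n, [/\ \det B != 0, forall i, H (row i B) &
    forall w, H w -> exists a, w = a *m B].
Proof.
move=> HB dB0 HB0.
pose P (d : nat) := `[< exists B : 'M[int]_n,
  [/\ \det B != 0, forall i, H (row i B) & absz (\det B) = d] >].
have exP : exists d, P d by exists (absz (\det B0)); apply/asboolP; exists B0.
have [d /asboolP[B [dB HrB dE]] dmin] := ex_minnP exP.
exists B; split=> // w Hw.
have HZ x y (m : int) : H x -> H y -> H (x - m *: y).
  move=> Hx Hy; have H0' : H 0 by rewrite -(subrr x); exact: HB.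
  have HN z : H z -> H (- z) by move=> Hz; rewrite -sub0r; exact: HB.
  have Hn k : H (y *+ k).
    elim: k => [|k IH]; first by rewrite mulr0n.
    by rewrite mulrSr -[y in _ + y]opprK; apply: HB => //; exact: HN.
  apply: HB => //; rewrite -[m]intz scaler_int; case: m => k; first exact: Hn.
  by rewrite NegzE mulrNz; apply: HN; exact: Hn.
pose rep (x : 'rV[int]_n) i : 'M[int]_n :=
  \matrix_(k, l) if k == i then x ord0 l else B k l.
(* Cramer's rule: up to division by det B, this is the i-th coordinate of x in the basis given by
   the rows of B. *)
have det_rep x i : \det (rep x i) = (x *m \adj B) ord0 i.
  rewrite (expand_det_row _ i) mxE; apply: eq_bigr => j _.
  rewrite !mxE eqxx; congr (_ * _); rewrite /cofactor; congr (_ * \det _).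
  by apply/matrixP => k l; rewrite !mxE eq_sym (negPf (neq_lift _ _)).
have dvd i : (\det B %| (w *m \adj B) ord0 i)%Z.
  pose c := ((w *m \adj B) ord0 i %/ \det B)%Z.
  pose w' := w - c *: row i B.
  have Hw' : H w' by exact: HZ.
  have dw' : \det (rep w' i) = ((w *m \adj B) ord0 i %% \det B)%Z.
    rewrite det_rep mulmxBl -scalemxAl -row_mul mul_mx_adj /modz -/c.
    by clear Hw'; move: (w *m _) @c @w' => z c; rewrite !mxE eqxx mulr1n.
  have lt : (absz (\det (rep w' i)) < d)%N.
    rewrite dw' -dE -ltz_nat gez0_abs ?modz_ge0//.
    by rewrite ltz_mod.
  apply/dvdz_mod0P; rewrite -dw'; apply/eqP; apply: contraLR lt => nz.
  rewrite -leqNgt; apply: dmin; apply/asboolP; exists (rep w' i); split => // k.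
  have [->|ki] := eqVneq k i.
    rewrite (_ : row i _ = w')//; apply/rowP => l.
    by rewrite !mxE eqxx.
  rewrite (_ : row k _ = row k B)//; apply/rowP => l.
  by rewrite !mxE (negPf ki).
exists (\row_i ((w *m \adj B) ord0 i %/ \det B)%Z).
set a := \row_i _.
suff /rowP E : \det B *: w = \det B *: (a *m B).
  by apply/rowP => l; apply: (mulfI dB); have := E l; rewrite mxE [RHS]mxE.
rewrite -mul_mx_scalar -mul_adj_mx mulmxA scalemxAl; congr (_ *m _).
by apply/rowP => i; rewrite /a [RHS]mxE [X in _ * X]mxE mulrC divzK.
Qed.
Section cubic_integers.
Context (K : fieldExtType rat) (R : realType) (sigma : embeddings K R 1 1).
Local Notation C := R[i].
Local Notation tau := (tau sigma).

Lemma is_intD (x y : K) : is_int x -> is_int y -> is_int (x + y).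
Proof. exact: integral_add. Qed.

Lemma is_intB (x y : K) : is_int x -> is_int y -> is_int (x - y).
Proof. exact: integral_sub. Qed.

Lemma is_intM (x y : K) : is_int x -> is_int y -> is_int (x * y).
Proof. exact: integral_mul. Qed.

Lemma is_int_intr (m : int) : is_int (m%:~R : K).
Proof. exact: integral_id. Qed.

Lemma is_intX (x : K) k : is_int x -> is_int (x ^+ k).
Proof.
move=> xi; elim: k => [|k IH]; first exact: (is_int_intr 1).
by rewrite exprS; exact: is_intM.
Qed.

Lemma is_int_sum n (F : 'I_n -> K) : (forall i, is_int (F i)) -> is_int (\sum_i F i).
Proof.
move=> Fi; elim/big_ind: _ => //; first exact: (is_int_intr 0).
exact: is_intD.
Qed.

Lemma tau_int (x : K) j : is_int x -> integralOver (intr : int -> C) (tau j x).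
Proof.
move=> /(integral_rmorph (tau j)) [p pm pr]; exists p => //.
by rewrite (eq_map_poly (g := tau j \o intr)) // => m; rewrite /= rmorph_int.
Qed.

Definition emb_mx (b : 'I_3 -> K) : 'M[C]_3 := \matrix_(i, j) tau j (b i).
Definition emb_diag (x : K) : 'M[C]_3 := diag_mx (\row_j tau j x).

(** The columns of [emb_mx b] are eigenvectors of any matrix of multiplication by x, with
    eigenvalues [tau j x]. Traces and determinants of such matrices thereby become sums and products
    of conjugates. *)
Lemma emb_mx_mul (b : 'I_3 -> K) (A : 'M[C]_3) (x : K) :
  (forall i j, tau j (x * b i) = \sum_k A i k * tau j (b k)) ->
  A *m emb_mx b = emb_mx b *m emb_diag x.
Proof.
move=> E; apply/matrixP => i j; rewrite mul_mx_diag !mxE -rmorphM mulrC E.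
by apply: eq_bigr => k _; rewrite mxE.
Qed.

Section generator.
Context (u : K).
Hypotheses (u_gen : <<1; u>>%VS = {:K}%VS) (u_int : is_int u).

Let ub (i : 'I_3) : K := u ^+ i.

Lemma power_coord (x : K) : exists c : 'I_3 -> rat, x = \sum_k (c k)%:A * u ^+ k.
Proof.
have deg3 : adjoin_degree 1 u = 3%N.
  by rewrite -(dim_cubic sigma) -u_gen dim_Fadjoin dimv1 muln1.
have sz : (size (Fadjoin_poly 1 u x) <= 3)%N by rewrite -deg3 size_Fadjoin_poly.
have /polyOver1P[q qE] := Fadjoin_polyOver 1 u x.
exists (fun k => q`_k).
rewrite -[LHS](@Fadjoin_poly_eq _ _ 1%AS u) ?u_gen ?memvf//.
rewrite (horner_coef_wide _ sz); apply: eq_bigr => k _.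
by rewrite qE coef_map.
Qed.

Lemma emb_mx_powers_unit : emb_mx ub \in unitmx.
Proof.
have -> : emb_mx ub = Vandermonde 3 (\row_j tau j u).
  by apply/matrixP => i j; rewrite !mxE rmorphXn.
rewrite unitmxE det_Vandermonde unitfE; apply/prodf_neq0 => i _.
apply/prodf_neq0 => j ij; rewrite !mxE subr_eq0; apply/eqP.
by move/(tau_gen_inj u_gen) => ji; move: ij; rewrite ji ltnn.
Qed.

(** Multiplication by x has a rational matrix in the basis 1, u, u^2, and this matrix is conjugate
    over the complex numbers to the diagonal of the conjugates of x. *)
Lemma trace_ex (x : K) : exists q : rat, ratr q = \sum_j tau j x.
Proof.
have [c cE] := choice (fun i : 'I_3 => power_coord (x * u ^+ i)).
pose A : 'M[rat]_3 := \matrix_(i, k) c i k.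
exists (\tr A).
have E : map_mx ratr A *m emb_mx ub = emb_mx ub *m emb_diag x.
  apply: emb_mx_mul => i j; rewrite {1}/ub cE rmorph_sum; apply: eq_bigr => k _.
  rewrite rmorphM !mxE; congr (_ * _).
  exact: (fmorph_eq_rat (tau j \o GRing.in_alg K)).
have /(congr1 (fun B => \tr (B *m invmx (emb_mx ub)))) := E.
rewrite mulmxK ?emb_mx_powers_unit// mxtrace_mulC mulmxA mulVmx ?emb_mx_powers_unit//.
rewrite mul1mx mxtrace_diag trace_map_mx => ->.
by apply: eq_bigr => j _; rewrite mxE.
Qed.

Lemma trace_int (x : K) : is_int x -> exists m : int, m%:~R = \sum_j tau j x.
Proof.
move=> xi; have [q qE] := trace_ex x.
have [|m mE] := @rat_integral_int C q.
  rewrite qE !big_ord_recl big_ord0 addr0.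
  by apply: integral_add; [|apply: integral_add]; exact: tau_int.
by exists m; rewrite -qE mE ratr_int.
Qed.

Let trace_row (x : K) (w : 'rV[int]_3) :=
  forall k, (w ord0 k)%:~R = \sum_j tau j (x * u ^+ k).

Let trace_rowE b (w : 'I_3 -> 'rV[int]_3) : (forall i, trace_row (b i) (w i)) ->
  map_mx intr (\matrix_i w i) = emb_mx b *m (emb_mx ub)^T.
Proof.
move=> bw; apply/matrixP => i k; rewrite !mxE bw.
by apply: eq_bigr => j _; rewrite rmorphM !mxE.
Qed.

Let trace_row_ex x : is_int x -> exists w, trace_row x w.
Proof.
move=> xi.
have [w wE] := choice (fun k : 'I_3 => trace_int (is_intM xi (is_intX k u_int))).
by exists (\row_k w k) => k; rewrite mxE wE.
Qed.

Lemma det_map_intr_neq0 n (A : 'M[int]_n) :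
  (\det A != 0) = (map_mx (intr : int -> C) A \in unitmx).
Proof. by rewrite unitmxE det_map_mx unitfE intr_eq0. Qed.

Lemma integral_basis : exists b : 'I_3 -> K,
  [/\ forall i, is_int (b i), emb_mx b \in unitmx &
      forall x, is_int x -> exists a : 'rV[int]_3, x = \sum_k (a ord0 k)%:~R * b k].
Proof.
pose H w := exists2 x, is_int x & trace_row x w.
have HB w w' : H w -> H w' -> H (w - w').
  move=> [x xi xw] [y yi yw]; exists (x - y); first exact: is_intB.
  move=> k; rewrite !mxE rmorphB [X in X - _]xw [X in _ - X]yw -sumrB.
  by apply: eq_bigr => j _; rewrite mulrBl rmorphB.
have [w0 w0E] := choice (fun i : 'I_3 => trace_row_ex (is_intX i u_int)).
(* The entries are the traces of u^(i + k): a Vandermonde matrix times its transpose, invertible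
   because the conjugates of u are distinct. *)
have dB0 : \det (\matrix_i w0 i) != 0.
  rewrite det_map_intr_neq0 (trace_rowE w0E).
  by rewrite unitmx_mul unitmx_tr emb_mx_powers_unit.
have HB0 i : H (row i (\matrix_i w0 i)).
  by rewrite rowK; exists (u ^+ i) => //; exact: is_intX.
have [B [dB HrB HwB]] := lattice_basis HB dB0 HB0.
have b_ex (i : 'I_3) : exists x, is_int x /\ trace_row x (row i B).
  by have [x] := HrB i; exists x.
have [b bP] := choice b_ex.
have bi i : is_int (b i) by have [] := bP i.
have bB i : trace_row (b i) (row i B) by have [] := bP i.
have BE : map_mx intr B = emb_mx b *m (emb_mx ub)^T.
  rewrite -(trace_rowE bB); congr map_mx.
  by apply/row_matrixP => i; rewrite rowK.
exists b; split=> // [|x xi].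
  by move: dB; rewrite det_map_intr_neq0 BE unitmx_mul => /andP[].
have [w wE] := trace_row_ex xi.
have [|a aE] := HwB w; first by exists x.
exists a; apply/eqP; rewrite -subr_eq0; apply/eqP.
set y := _ - _.
(* The entries of this product are the traces of y, yu and yu^2. As the Vandermonde matrix is
   invertible, their vanishing gives y = 0. *)
suff : \row_j tau j y *m (emb_mx ub)^T = 0.
  move/(congr1 (mulmx^~ (invmx (emb_mx ub)^T))).
  rewrite mulmxK ?unitmx_tr ?emb_mx_powers_unit// mul0mx => /rowP/(_ ord0).
  by rewrite !mxE => /eqP; rewrite fmorph_eq0 => /eqP.
have yE : \row_j tau j y = \row_j tau j x - map_mx intr a *m emb_mx b.
  apply/rowP => j; rewrite !mxE /y rmorphB rmorph_sum; congr (_ - _).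
  by apply: eq_bigr => k _; rewrite !mxE rmorphM rmorph_int.
rewrite yE mulmxBl -mulmxA -BE -map_mxM -aE.
apply/rowP => k; rewrite !mxE /= -/(intr _) wE; apply/eqP; rewrite subr_eq0; apply/eqP.
by apply: eq_bigr => j _; rewrite !mxE -rmorphM.
Qed.

End generator.
End cubic_integers.

(** * Counting the cokernel of an integer matrix *)

Lemma coker_card n (M : 'M[int]_n) : \det M != 0 ->
  exists (T : finType) (f : 'rV[int]_n -> T),
  [/\ forall x y, f x = f y <-> exists a, x - y = a *m M,
      forall t, exists x, f x = t & #|T| = absz (\det M)].
Proof.
move=> dM; have [L Lu [S Su [d _ ME]]] := int_Smith_normal_form M.
pose dn (i : 'I_n) : nat := absz d`_i.
pose D : 'M[int]_n := \matrix_(i, j) (d`_i *+ (i == j :> nat)).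
have DE : D = diag_mx (\row_i d`_i).
  by apply/matrixP => i j; rewrite !mxE.
have absz_det_unit (A : 'M[int]_n) : A \in unitmx -> absz (\det A) = 1%N.
  move=> Au; have /eqP := congr1 (absz \o determinant) (mulmxV Au).
  by rewrite /= det_mulmx det1 abszM muln_eq1 => /andP[/eqP].
have detE : absz (\det M) = (\prod_(i < n) dn i)%N.
  rewrite ME !det_mulmx !abszM (absz_det_unit L)// (absz_det_unit S)// mul1n muln1 -/D DE det_diag.
  rewrite (big_morph absz abszM (erefl _)).
  by apply: eq_bigr => i _; rewrite mxE.
have d0 (i : 'I_n) : (0 < dn i)%N.
  rewrite lt0n; apply: contraNneq dM => di.
  by rewrite -absz_eq0 detE (bigD1 i)//= -/(dn i) di mul0n.
pose T : finType := {dffun forall i : 'I_n, 'I_(dn i)}.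
have lt (z : int) (i : 'I_n) : (absz (z %% d`_i)%Z < dn i)%N.
  have di : d`_i != 0 by rewrite -absz_gt0; exact: d0.
  by rewrite -ltz_nat gez0_abs ?modz_ge0// ltz_mod.
(* With M = L D S and L, S invertible over the integers, x lies in the row lattice of M exactly when
   each coordinate of x S^-1 is divisible by the matching diagonal entry of D; the residues
   therefore classify the cosets. *)
pose f (x : 'rV[int]_n) : T := [ffun i => Ordinal (lt ((x *m invmx S) ord0 i) i)].
exists T, f; split.
- move=> x y; split=> [fxy|[a xy]].
    pose z := (x - y) *m invmx S.
    have dvd i : (d`_i %| z ord0 i)%Z.
      have di : d`_i != 0 by rewrite -absz_gt0; exact: d0.
      have /(congr1 val) /= := congr1 (fun g : T => g i) fxy.
      rewrite !ffunE /= => /(congr1 Posz); rewrite !gez0_abs ?modz_ge0// => /eqP.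
      by rewrite eqz_mod_dvd /z mulmxBl !mxE.
    pose q : 'rV[int]_n := \row_i (z ord0 i %/ d`_i)%Z.
    exists (q *m invmx L).
    rewrite ME !mulmxA mulmxKV// -/D -[LHS](mulmxKV Su) -/z; congr (_ *m _).
    apply/rowP => i; rewrite DE mul_mx_diag [RHS]mxE [X in X * _]mxE [X in _ * X]mxE.
    by rewrite divzK.
  apply/ffunP => i; apply: val_inj; rewrite !ffunE /=; congr absz.
  apply/eqP; rewrite eqz_mod_dvd.
  have -> : (x *m invmx S) ord0 i - (y *m invmx S) ord0 i = ((x - y) *m invmx S) ord0 i.
    by rewrite mulmxBl !mxE.
  rewrite xy ME !mulmxA mulmxK// -/D DE mul_mx_diag mxE [X in _ * X]mxE.
  exact: dvdz_mull.
- move=> t; exists ((\row_i (val (t i))%:Z) *m S).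
  apply/ffunP => i; apply: val_inj; rewrite !ffunE /= mulmxK// mxE.
  by rewrite -modz_abs modz_small ?absz_nat//= ltz_nat; exact: ltn_ord.
- rewrite card_dep_ffun detE foldrE big_map big_enum /=.
  by apply: eq_bigr => i _; rewrite card_ord.
Qed.
Lemma normc_nonneg (R : rcfType) (x : R[i]) : 0 <= Normc.normc x.
Proof. by case: x => a b; exact: sqrtr_ge0. Qed.

(** * Units, norms, and the lattice of integers *)

Section unit_generates.
Context (K : fieldExtType rat) (R : realType) (sigma : embeddings K R 1 1).

Lemma rational_integer (x : K) : x \in 1%VS -> is_int x -> exists m : int, x = m%:~R.
Proof.
move=> /vlineP[c ->] xi.
have [|m ->] := @rat_integral_int R[i] c.
  rewrite -(fmorph_eq_rat (tau sigma ord0 \o GRing.in_alg K)).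
  exact: (tau_int sigma).
by exists m; exact: (rmorph_int (GRing.in_alg K)).
Qed.

(** The degree 3 is prime, so u generates either K or the rationals. In the second case u and its
    inverse are rational integers, whence u^2 = 1. *)
Lemma unit_generates (u : K) : u != 0 -> is_int u -> is_int u^-1 ->
  u ^+ 2 != 1 -> <<1; u>>%VS = {:K}%VS.
Proof.
move=> u0 ui uVi u2.
have d3 : (\dim <<1; u>>%VS %| 3)%N.
  by rewrite -(dim_cubic sigma) field_dimS// subvf.
have [] : \dim <<1; u>>%VS = 1%N \/ \dim <<1; u>>%VS = 3%N.
  have : (\dim <<1; u>>%VS \in divisors 3) by rewrite -dvdn_divisors.
  by rewrite !inE => /orP[]/eqP; [left | right].
- move=> d1; have u1 : u \in 1%VS.
    have -> : 1%VS = <<1; u>>%VS :> {vspace K}.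
      by apply/eqP; rewrite eqEdim sub1v d1 dimv1.
    exact: memv_adjoin.
  have [m mE] := rational_integer u1 ui.
  have [|m' m'E] := rational_integer _ uVi; first by rewrite memvV.
  have mm' : m * m' = 1.
    apply/eqP; rewrite -(eqr_int R) rmorphM /= -!(rmorph_int (sigma1 sigma)).
    by rewrite -mE -m'E -rmorphM divff// rmorph1.
  case/negP: u2; rewrite mE.
  have /eqP : absz (m * m') = 1%N by rewrite mm'.
  rewrite abszM muln_eq1 => /andP[/eqP m1 _].
  by rewrite -rmorphXn /= -real_normK ?num_real// -abszE m1 expr1n.
- by move=> dE; apply/eqP; rewrite eqEdim subvf (dim_cubic sigma) dE.
Qed.

End unit_generates.

Section integer_lattice.
Context (K : fieldExtType rat) (R : realType) (sigma : embeddings K R 1 1).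
Local Notation tau := (tau sigma).
Context (b : 'I_3 -> K).
Hypotheses (b_int : forall i, is_int (b i)) (b_unit : emb_mx sigma b \in unitmx)
  (b_span : forall x, is_int x ->
     exists a : 'rV[int]_3, x = \sum_k (a ord0 k)%:~R * b k).

Definition lat (a : 'rV[int]_3) : K := \sum_k (a ord0 k)%:~R * b k.

Lemma latB x y : lat (x - y) = lat x - lat y.
Proof.
rewrite /lat -sumrB; apply: eq_bigr => k _.
by rewrite !mxE rmorphB mulrBl.
Qed.

Lemma latD x y : lat (x + y) = lat x + lat y.
Proof.
rewrite /lat -big_split; apply: eq_bigr => k _.
by rewrite !mxE rmorphD mulrDl.
Qed.

Lemma lat_is_int a : is_int (lat a).
Proof. by apply: is_int_sum => k; apply: is_intM => //; exact: is_int_intr. Qed.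

Lemma tau_lat j a : tau j (lat a) = (map_mx intr a *m emb_mx sigma b) ord0 j.
Proof.
rewrite mxE rmorph_sum; apply: eq_bigr => k _.
by rewrite !mxE rmorphM rmorph_int.
Qed.

Lemma lat_eq0 a : lat a = 0 -> a = 0.
Proof.
move=> a0; have : map_mx intr a *m emb_mx sigma b = 0.
  by apply/rowP => j; rewrite -tau_lat a0 rmorph0 mxE.
move/(congr1 (mulmx^~ (invmx (emb_mx sigma b)))).
rewrite mulmxK// mul0mx => /rowP aE; apply/rowP => k.
by apply/eqP; have := aE k; rewrite !mxE => /eqP; rewrite intr_eq0.
Qed.

Lemma lat_inj : injective lat.
Proof.
by move=> x y xy; apply/eqP; rewrite -subr_eq0; apply/eqP/lat_eq0; rewrite latB xy subrr.
Qed.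

Lemma lat_surj x : is_int x -> exists a, lat a = x.
Proof. by move=> /b_span[a ->]; exists a. Qed.

(** Row i holds the coordinates of v * b i. Conjugating by [emb_mx] makes the matrix diagonal, which
    identifies its determinant with the norm of v. *)
Lemma mult_mx_ex v : is_int v -> exists M : 'M[int]_3,
  (forall a, lat (a *m M) = v * lat a) /\ (\det M)%:~R = \prod_j tau j v.
Proof.
move=> vi; have [w wE] := choice (fun i => lat_surj (is_intM vi (b_int i))).
exists (\matrix_i w i).
have E : map_mx intr (\matrix_i w i) *m emb_mx sigma b = emb_mx sigma b *m emb_diag sigma v.
  apply: emb_mx_mul => i j; rewrite -wE tau_lat mxE.
  by apply: eq_bigr => k _; rewrite !mxE.
split=> [a|].
  have latE c : lat c = \sum_k (c ord0 k)%:~R * b k by [].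
  apply: (fmorph_inj (tau ord0)).
  rewrite rmorphM !tau_lat map_mxM -mulmxA E mulmxA mul_mx_diag.
  by rewrite [LHS]mxE [X in _ * X]mxE mulrC.
have /(congr1 determinant) := E.
rewrite !det_mulmx det_map_mx mulrC => /mulfI -> //.
by rewrite det_diag; apply: eq_bigr => j _; rewrite mxE.
Qed.

Lemma norm_int x : is_int x ->
  exists m : int, m%:~R = sigma1 sigma x * Normc.normc (sigma2 sigma x) ^+ 2.
Proof.
move=> /mult_mx_ex[M [_ dM]]; exists (\det M); apply: (fmorph_inj (real_complex R)).
by rewrite rmorph_int dM prod_tau.
Qed.

(** The norms of x and of its inverse are integers with product 1, and positivity at the real place
    excludes -1. *)
Lemma norm_unit x : is_int x -> is_int x^-1 -> x != 0 -> 0 < sigma1 sigma x ->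
  sigma1 sigma x * Normc.normc (sigma2 sigma x) ^+ 2 = 1.
Proof.
move=> xi xVi x0 xpos.
have [m mE] := norm_int xi; have [m' m'E] := norm_int xVi.
have n0 : 0 < Normc.normc (sigma2 sigma x).
  rewrite lt0r normc_nonneg andbT; apply: contra x0 => /eqP/Normc.eq0_normc /eqP.
  by rewrite fmorph_eq0.
have m0 : 0 < m by rewrite -(ltr0z R) mE mulr_gt0 ?exprn_gt0.
have : m * m' = 1.
  apply/eqP; rewrite -(eqr_int R) rmorphM /= mE m'E !fmorphV Normc.normcV.
  by apply/eqP; field; rewrite !gt_eqF.
move=> mm'; rewrite -mE.
have /eqP : absz (m * m') = 1%N by rewrite mm'.
rewrite abszM muln_eq1 => /andP[/eqP m1 _].
by rewrite -(gtz0_abs m0) m1.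
Qed.

(** The norm is an integer, so it must be 0. This is what makes the translations by O_K discrete on
    the product of the two coordinates. *)
Lemma small_int_eq0 x : is_int x ->
  `|sigma1 sigma x| * Normc.normc (sigma2 sigma x) ^+ 2 < 1 -> x = 0.
Proof.
move=> xi lt1; have [m mE] := norm_int xi.
have : `|m%:~R : R| < 1.
  by rewrite mE normrM [X in _ * X]ger0_norm// exprn_ge0// normc_nonneg.
rewrite -intr_norm (ltr_int R _ 1) -[1]/(1%:Z) => m1.
have m0 : m = 0 by apply/eqP; rewrite -normr_eq0 eq_le normr_ge0 andbT -ltzD1 add0r.
move: mE; rewrite m0 => /esym/eqP; rewrite mulf_eq0 expf_eq0 /= => /orP[|].
  by rewrite fmorph_eq0 => /eqP.
by move=> /eqP/Normc.eq0_normc/eqP; rewrite fmorph_eq0 => /eqP.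
Qed.

End integer_lattice.
(** * The Oeljeklaus-Toma action *)

Section half_plane.
Context (R : realType).
Local Notation C := R[i].
Local Notation Y := (set_type (@HsCt R 1 1)).

Definition zcoord (y : Y) : C := (set_val y).1 ord0 ord0.
Definition wcoord (y : Y) : C := (set_val y).2 ord0 ord0.

Lemma zcoord_continuous : continuous zcoord.
Proof.
move=> y; apply: (@continuous_comp _ _ _ set_val (fun z : 'rV[C]_1 * 'rV[C]_1 => z.1 ord0 ord0)).
  exact: (@initial_continuous _ _ set_val).
apply: (@continuous_comp _ _ _ fst (fun z : 'rV[C]_1 => z ord0 ord0)).
  exact: cvg_fst.
exact: coord_continuous.
Qed.

Lemma wcoord_continuous : continuous wcoord.
Proof.
move=> y; apply: (@continuous_comp _ _ _ set_val (fun z : 'rV[C]_1 * 'rV[C]_1 => z.2 ord0 ord0)).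
  exact: (@initial_continuous _ _ set_val).
apply: (@continuous_comp _ _ _ snd (fun z : 'rV[C]_1 => z ord0 ord0)).
  exact: cvg_snd.
exact: coord_continuous.
Qed.

Lemma half_plane_eq (y y' : Y) : zcoord y = zcoord y' -> wcoord y = wcoord y' -> y = y'.
Proof.
move=> e1 e2; suff : set_val y = set_val y' by exact: val_inj.
move: e1 e2; rewrite /zcoord /wcoord.
case: (set_val y) => a b; case: (set_val y') => a' b' /= e1 e2.
by congr (_, _); apply/rowP => j; rewrite (ord1 j).
Qed.

Lemma half_plane_continuous (T : topologicalType) (f : T -> Y) :
  continuous (fun x => zcoord (f x)) -> continuous (fun x => wcoord (f x)) ->
  continuous f.
Proof.
move=> f1 f2; apply: continuous_comp_initial.
have -> : set_val \o f = fun x => (\row_j zcoord (f x), \row_j wcoord (f x)).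
  apply: funext => x /=; rewrite /zcoord /wcoord; case: (set_val (f x)) => a b.
  by congr (_, _); apply/rowP => j; rewrite mxE ord1.
have row_cont (g : T -> C) : continuous g -> continuous (fun x => \row_(j < 1) g x).
  by move=> gc; apply: rV_continuous => j; under eq_fun do rewrite mxE.
by move=> x; exact: (cvg_pair (row_cont _ f1 x) (row_cont _ f2 x)).
Qed.

Lemma zcoord_Im_gt0 (y : Y) : 0 < complex.Im (zcoord y).
Proof. by have := set_valP y => /(_ ord0). Qed.

Lemma half_plane_subproof (z w : C) : 0 < complex.Im z ->
  (\row_j z, \row_j w) \in @HsCt R 1 1.
Proof. by move=> z0; apply/mem_set => j /=; rewrite mxE. Qed.

Definition half_plane_point (z w : C) (h : 0 < complex.Im z) : Y :=
  exist (fun y => y \in @HsCt R 1 1) _ (half_plane_subproof w h).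

Lemma zcoord_point z w h : zcoord (@half_plane_point z w h) = z.
Proof. by rewrite /zcoord /= mxE. Qed.

Lemma wcoord_point z w h : wcoord (@half_plane_point z w h) = w.
Proof. by rewrite /wcoord /= mxE. Qed.

Lemma half_plane_hausdorff : hausdorff_space Y.
Proof.
rewrite open_hausdorff => x y xy.
have sep (f : Y -> C) : continuous f -> f x <> f y ->
    exists2 AB : set_predType Y * set_predType Y, x \in AB.1 /\ y \in AB.2 &
    [/\ open AB.1, open AB.2 & AB.1 `&` AB.2 == set0].
  move=> fc /eqP fxy; have := @norm_hausdorff _ C; rewrite open_hausdorff.
  move=> /(_ _ _ fxy)[[A B] /= [Ax By] [oA oB /eqP AB]].
  exists (f @^-1` A, f @^-1` B) => /=.
    by split; apply/mem_set; [move: Ax | move: By]; rewrite inE.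
  split; [by apply: open_comp => // z _; exact: fc..|].
  by rewrite -preimage_setI AB preimage_set0.
have [exy|] := pselect (zcoord x = zcoord y); last exact/sep/zcoord_continuous.
apply: (sep wcoord); first exact: wcoord_continuous.
by move=> wxy; move/eqP: xy; apply; exact: half_plane_eq.
Qed.

Lemma Re_continuous : continuous (@complex.Re R : C -> R).
Proof.
move=> z A /nbhs_ballP[e /= e0 eA].
suff : nbhs z (@complex.Re R @^-1` A) by [].
apply/nbhs_ballP; exists e%:C%C; first by rewrite /= ltcR.
move=> t zt; apply: eA; move: zt; rewrite -!ball_normE /= => zt.
by rewrite -raddfB -ltcR; apply: le_lt_trans zt; exact: normc_ge_Re.
Qed.

Lemma Im_continuous : continuous (@complex.Im R : C -> R).
Proof.
have -> : @complex.Im R = fun z => complex.Re (- 'i%C * z).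
  by apply: funext => -[a b] /=; rewrite oppr0 mul0r sub0r mulN1r opprK.
move=> z; apply: (@continuous_comp _ _ _ (fun z : C => - 'i%C * z) (@complex.Re R)).
  exact: mulrl_continuous.
exact: Re_continuous.
Qed.

Lemma Re_scale (c : R) (z : C) : complex.Re (c%:C%C * z) = c * complex.Re z.
Proof. by case: z => a b /=; rewrite mul0r subr0. Qed.

Lemma Im_scale (c : R) (z : C) : complex.Im (c%:C%C * z) = c * complex.Im z.
Proof. by case: z => a b /=; rewrite mul0r addr0. Qed.

Lemma complex_continuous (T : topologicalType) (f : T -> C) :
  continuous (fun x => complex.Re (f x)) -> continuous (fun x => complex.Im (f x)) ->
  continuous f.
Proof.
move=> fr fi x A /nbhs_ballP[e /= e0 eA].
(* Radii of balls in the complex plane are themselves complex numbers; positivity forces this one to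
   be real. *)
have eR : e = (complex.Re e)%:C%C.
  by case: e e0 {eA} => a b; rewrite ltcE /= => /andP[/eqP-> _].
have e'0 : 0 < complex.Re e / 2 by rewrite divr_gt0// -ltcR -eR.
have hr : \forall t \near x, ball (complex.Re (f x)) (complex.Re e / 2) (complex.Re (f t)).
  by apply: (fr x); exact: nbhsx_ballx.
have hi : \forall t \near x, ball (complex.Im (f x)) (complex.Re e / 2) (complex.Im (f t)).
  by apply: (fi x); exact: nbhsx_ballx.
apply: filterS2 hr hi => t; rewrite -!ball_normE /= => hr hi; apply: eA.
rewrite -ball_normE /= normc_def eR ltcR !raddfB.
move: (complex.Re (f x) - _) (complex.Im (f x) - _) (complex.Re e) e'0 hr hi => a b d d0 ha hb.
have d1 : 0 < d by lra.
rewrite -(gtr0_norm d1) -sqrtr_sqr ltr_sqrt ?exprn_gt0//.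
rewrite -(real_normK (num_real a)) -(real_normK (num_real b)).
have := normr_ge0 a; have := normr_ge0 b; nra.
Qed.

Lemma mix_subproof (t : R) (y y' : Y) :
  0 < complex.Im ((1 - clamp t)%:C%C * zcoord y + (clamp t)%:C%C * zcoord y').
Proof.
have := zcoord_Im_gt0 y; have := zcoord_Im_gt0 y'.
case: (zcoord y) => a b; case: (zcoord y') => a' b' /= b'0 b0.
rewrite !mul0r !addr0; have := clamp_ge0 t; have := clamp_le1 t.
rewrite le_eqVlt => /predU1P[->|t1] t0; first by rewrite subrr mul0r add0r mul1r.
by rewrite ltr_pwDl ?mulr_gt0 ?subr_gt0 ?mulr_ge0// ltW.
Qed.

Definition hmix (t : R) (y y' : Y) : Y :=
  half_plane_point ((1 - clamp t)%:C%C * wcoord y + (clamp t)%:C%C * wcoord y')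
    (mix_subproof t y y').

Lemma hmix0 y y' : hmix 0 y y' = y.
Proof.
by apply: half_plane_eq; rewrite ?zcoord_point ?wcoord_point clamp0 subr0 rmorph1 rmorph0 mul1r mul0r addr0.
Qed.

Lemma hmix1 y y' : hmix 1 y y' = y'.
Proof.
by apply: half_plane_eq; rewrite ?zcoord_point ?wcoord_point clamp1 subrr rmorph1 rmorph0 mul1r mul0r add0r.
Qed.

Lemma hmixxx t y : hmix t y y = y.
Proof.
by apply: half_plane_eq; rewrite ?zcoord_point ?wcoord_point -mulrDl -rmorphD subrK rmorph1 mul1r.
Qed.

Lemma hmix_continuous (T : topologicalType) (t : T -> R) (a b : T -> Y) :
  continuous t -> continuous a -> continuous b ->
  continuous (fun x => hmix (t x) (a x) (b x)).
Proof.
move=> tc ac bc.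
have cc : continuous (fun x => clamp (t x)).
  by move=> x; apply: continuous_comp; [exact: tc | exact: clamp_continuous].
have cc' : continuous (fun x => 1 - clamp (t x)).
  by apply: fun_subr_continuous => //; exact: fun_cst_continuous.
have main (f : Y -> R) : continuous f ->
    continuous (fun x => (1 - clamp (t x)) * f (a x) + clamp (t x) * f (b x)).
  move=> fc; have fac : continuous (fun x => f (a x)).
    by move=> x; apply: continuous_comp; [exact: ac | exact: fc].
  have fbc : continuous (fun x => f (b x)).
    by move=> x; apply: continuous_comp; [exact: bc | exact: fc].
  by apply: fun_addr_continuous; exact: fun_mulr_continuous.
have mainC (f : Y -> C) : continuous f ->
    continuous (fun x => (1 - clamp (t x))%:C%C * f (a x) + (clamp (t x))%:C%C * f (b x)).
  move=> fc; apply: complex_continuous.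
    under eq_fun do rewrite raddfD /= !Re_scale.
    by apply: (main (fun y => complex.Re (f y))) => y;
      exact: (continuous_comp (fc y) (@Re_continuous _)).
  under eq_fun do rewrite raddfD /= !Im_scale.
  by apply: (main (fun y => complex.Im (f y))) => y;
    exact: (continuous_comp (fc y) (@Im_continuous _)).
apply: half_plane_continuous.
  under eq_fun do rewrite zcoord_point; exact/mainC/zcoord_continuous.
under eq_fun do rewrite wcoord_point; exact/mainC/wcoord_continuous.
Qed.

End half_plane.
Section OT_quotient.
Context (K : fieldExtType rat) (R : realType) (sigma : embeddings K R 1 1).
Local Notation C := R[i].
Local Notation Y := (set_type (@HsCt R 1 1)).
Local Notation s1 := (sigma1 sigma).
Local Notation s2 := (sigma2 sigma).
Context (b : 'I_3 -> K).
Hypotheses (b_int : forall i, is_int (b i)) (b_unit : emb_mx sigma b \in unitmx)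
  (b_span : forall x, is_int x ->
     exists a : 'rV[int]_3, x = \sum_k (a ord0 k)%:~R * b k).
Context (v : K).
Hypotheses (v0 : v != 0) (v_int : is_int v) (vV_int : is_int v^-1)
  (v_pos : 0 < s1 v) (v_neq1 : s1 v != 1).
Local Notation lat := (lat b).
Local Notation X := (OT_manifold sigma (cyclic_subgroup v)).

Lemma is_int_exprz (k : int) : is_int (v ^ k).
Proof.
case: k => k; first by rewrite -exprnP; exact: is_intX.
have -> : v ^ Negz k = v^-1 ^+ k.+1 by rewrite exprVn.
exact: is_intX.
Qed.

Lemma s1_exprz_gt0 (k : int) : 0 < s1 (v ^ k).
Proof. by rewrite fmorphXz exprz_gt0. Qed.

Lemma lat_exprz_ex (k : int) (c : 'rV[int]_3) : exists d, lat d = v ^ k * lat c.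
Proof. by apply: (lat_surj b_span); apply: is_intM; [exact: is_int_exprz | exact: lat_is_int]. Qed.

(* [twist k] is multiplication by [v ^ k] in the coordinates of the integral basis. *)
Definition twist (k : int) (c : 'rV[int]_3) : 'rV[int]_3 := projT1 (cid (lat_exprz_ex k c)).

Lemma lat_twist k c : lat (twist k c) = v ^ k * lat c.
Proof. exact: projT2 (cid (lat_exprz_ex k c)). Qed.

Local Notation G := ('rV[int]_3 * int)%type.

Definition OT_mul (g h : G) : G := (g.1 + twist g.2 h.1, g.2 + h.2).

Lemma OT_act_subproof (g : G) (y : Y) :
  0 < complex.Im ((s1 (v ^ g.2))%:C%C * zcoord y + (s1 (lat g.1))%:C%C).
Proof.
by rewrite raddfD /= Im_scale addr0 mulr_gt0 ?s1_exprz_gt0// zcoord_Im_gt0.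
Qed.

Definition OT_action (g : G) (y : Y) : Y :=
  half_plane_point (s2 (v ^ g.2) * wcoord y + s2 (lat g.1)) (OT_act_subproof g y).

Lemma OT_actionE g y : set_val (OT_action g y) = OT_act sigma (lat g.1) (v ^ g.2) (set_val y).
Proof. by congr (_, _); apply/rowP => j; rewrite !mxE (ord1 j). Qed.

Lemma zcoord_action g y :
  zcoord (OT_action g y) = (s1 (v ^ g.2))%:C%C * zcoord y + (s1 (lat g.1))%:C%C.
Proof. by rewrite zcoord_point. Qed.

Lemma wcoord_action g y :
  wcoord (OT_action g y) = s2 (v ^ g.2) * wcoord y + s2 (lat g.1).
Proof. by rewrite wcoord_point. Qed.

Lemma OT_action_mul g h y : OT_action (OT_mul g h) y = OT_action g (OT_action h y).
Proof.
apply: half_plane_eq; rewrite ?zcoord_action ?wcoord_action /=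
  expfzDr// latD lat_twist !(rmorphD, rmorphM) /=; ring.
Qed.

Lemma OT_action_continuous g : continuous (OT_action g).
Proof.
have main (f : Y -> C) (c d : C) : continuous f -> continuous (fun y => c * f y + d).
  move=> fc; have fr : continuous (fun y => complex.Re (f y)).
    by move=> y; exact: (continuous_comp (fc y) (@Re_continuous _ _)).
  have fi : continuous (fun y => complex.Im (f y)).
    by move=> y; exact: (continuous_comp (fc y) (@Im_continuous _ _)).
  apply: complex_continuous.
    have -> : (fun y => complex.Re (c * f y + d)) = fun y =>
        complex.Re c * complex.Re (f y) - complex.Im c * complex.Im (f y) + complex.Re d.
      by apply: funext => y; case: (f y) c d => ? ? [? ?] [? ?].
    apply: fun_addr_continuous; last exact: fun_cst_continuous.
    by apply: fun_subr_continuous; apply: fun_mulr_continuous => //; exact: fun_cst_continuous.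
  have -> : (fun y => complex.Im (c * f y + d)) = fun y =>
      complex.Re c * complex.Im (f y) + complex.Im c * complex.Re (f y) + complex.Im d.
    by apply: funext => y; case: (f y) c d => ? ? [? ?] [? ?].
  apply: fun_addr_continuous; last exact: fun_cst_continuous.
  by apply: fun_addr_continuous; apply: fun_mulr_continuous => //; exact: fun_cst_continuous.
apply: half_plane_continuous.
  by under eq_fun do rewrite zcoord_action; exact/main/zcoord_continuous.
by under eq_fun do rewrite wcoord_action; exact/main/wcoord_continuous.
Qed.

Lemma OT_action_mix g t y y' :
  OT_action g (hmix t y y') = hmix t (OT_action g y) (OT_action g y').
Proof.
apply: half_plane_eq.
  rewrite zcoord_action !zcoord_point !rmorphB rmorph1; ring.
rewrite wcoord_action !wcoord_point !rmorphB rmorph1; ring.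
Qed.

Lemma s1_exprz_inj (k k' : int) : s1 (v ^ k) = s1 (v ^ k') -> k = k'.
Proof.
by rewrite !fmorphXz; exact: ieexprIz.
Qed.

(** The upper half plane alone decides: the imaginary part is scaled by s1(v)^k, which determines k
    since s1(v) is positive and not 1; the remaining real translation determines the element of
    O_K. *)
Lemma OT_action_free g h y : OT_action g y = OT_action h y -> g = h.
Proof.
case: g h => [a k] [a' k'] E.
have Ez := congr1 (@zcoord R) E; rewrite !zcoord_action /= in Ez.
have kk' : k = k'.
  have /(congr1 (@complex.Im R)) := Ez; rewrite !raddfD /= !Im_scale !addr0.
  move/mulIf; rewrite gt_eqF ?zcoord_Im_gt0// => /(_ isT).
  exact: s1_exprz_inj.
move: Ez; rewrite kk' => /addrI /(fmorph_inj (real_complex R)) /(fmorph_inj s1).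
by move=> /(lat_inj b_unit) ->.
Qed.

Lemma OT_action1 y : OT_action (0, 0) y = y.
Proof.
have l0 : lat 0 = 0 by have := latB b 0 0; rewrite !subrr.
apply: half_plane_eq; rewrite ?zcoord_action ?wcoord_action /= l0.
  by rewrite expr0z !rmorph1 !rmorph0 mul1r addr0.
by rewrite expr0z !rmorph1 !rmorph0 mul1r addr0.
Qed.

Definition OT_proj (y : Y) : X := (\pi_X y)%qT.

Lemma OT_projP y y' : OT_proj y = OT_proj y' <-> exists g, OT_action g y = y'.
Proof.
have E : OT_proj y = OT_proj y' <->
    OT_orbit sigma (cyclic_subgroup v) y = OT_orbit sigma (cyclic_subgroup v) y'.
  split=> [yy'|yy'].
    have /eqmodP : (y = y' %[mod {eq_quot OT_rel sigma (cyclic_subgroup v)}])%qT by [].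
    by move=> /asboolP.
  have /eqmodP : OT_rel sigma (cyclic_subgroup v) y y' by exact/asboolP.
  by [].
have orbitE z w : OT_orbit sigma (cyclic_subgroup v) z w <-> exists g, OT_action g z = w.
  split=> [[a [_ [ai [k _ <-] zw]]]|[g <-]].
    have [c ca] := lat_surj b_span ai.
    exists (c, k); suff : set_val (OT_action (c, k) z) = set_val w by exact: val_inj.
    by rewrite OT_actionE ca zw.
  exists (lat g.1), (v ^ g.2); split; first exact: lat_is_int.
    by exists g.2.
  exact: OT_actionE.
split=> [/E yy'|[g gy]].
  by apply/orbitE; rewrite yy'; apply/orbitE; exists (0, 0); exact: OT_action1.
apply/E.
have sub z w h : OT_action h z = w ->
    OT_orbit sigma (cyclic_subgroup v) w `<=` OT_orbit sigma (cyclic_subgroup v) z.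
  move=> hz x /orbitE[h' hx]; apply/orbitE; exists (OT_mul h' h).
  by rewrite OT_action_mul hz.
have [h hy'] : exists h, OT_action h y' = y.
  (* The inverse in the semidirect product: (a, k) has inverse (- v^(-k) a, - k). *)
  exists (- twist (- g.2) g.1, - g.2); rewrite -gy -OT_action_mul /OT_mul /= !addNr.
  exact: OT_action1.
by apply/seteqP; split; [exact: (sub _ _ h) | exact: (sub _ _ g)].
Qed.

Lemma OT_proj_surj x : exists y, OT_proj y = x.
Proof. by exists (repr x); rewrite /OT_proj reprK. Qed.

Lemma OT_proj_continuous : continuous OT_proj.
Proof. exact: pi_continuous. Qed.

(** The preimage of the image of A is the union of the translates of A, and each of these is a
    preimage of A under a homeomorphism of the group. *)
Lemma OT_proj_open A : open A -> open (OT_proj @` A).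
Proof.
move=> oA; suff : open (OT_proj @^-1` (OT_proj @` A)) by [].
rewrite openE => y [a Aa /esym/OT_projP[g ga]].
have : nbhs y (OT_action g @^-1` A).
  by apply: OT_action_continuous; rewrite ga; exact: open_nbhs_nbhs.
apply: filterS => z Az; exists (OT_action g z) => //.
by apply/esym/OT_projP; exists g.
Qed.

(** Take for mu the larger of s1(v) and its inverse: every nontrivial power of s1(v) is at least mu
    or at most 1 / mu. *)
Lemma s1_exprz_gap : exists2 mu : R, 1 < mu &
  forall k : int, k != 0 -> mu <= s1 v ^ k \/ mu * s1 v ^ k <= 1.
Proof.
have gap (l : R) : 1 < l -> forall k : int, k != 0 -> l <= l ^ k \/ l * l ^ k <= 1.
  move=> l1; have l0 : 0 < l by exact: lt_trans l1.
  have lS n : l <= l ^+ n.+1 by rewrite exprS ler_peMr ?(ltW l0)// exprn_ege1// ltW.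
  case=> [[//|n]|n] _; [left; exact: lS | right].
  have -> : l ^ Negz n = (l ^+ n.+1)^-1 by [].
  by rewrite ler_pdivrMr ?exprn_gt0// mul1r.
have [l1|l1|l1] := ltgtP (s1 v) 1; last by move: v_neq1; rewrite l1 eqxx.
  exists (s1 v)^-1; first by rewrite invf_gt1.
  move=> k k0; have := gap (s1 v)^-1; rewrite invf_gt1// => /(_ l1 (- k)).
  by rewrite oppr_eq0 => /(_ k0); rewrite exprz_inv opprK.
by exists (s1 v) => //; exact: gap.
Qed.

Lemma OT_proj_inj (y0 : Y) : exists2 W : set Y, nbhs y0 W &
  forall y y' : Y, W y -> W y' -> OT_proj y = OT_proj y' -> y = y'.
Proof.
have [mu mu1 gap] := s1_exprz_gap.
have I0 := zcoord_Im_gt0 y0; set I := complex.Im _ in I0.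
(* The solution of 1 + e = mu (1 - e). If two imaginary parts both lie within e I of I, their ratio
   is strictly between 1 / mu and mu, and the gap leaves only k = 0. *)
pose e := (mu - 1) / (mu + 1).
have e0 : 0 < e by rewrite divr_gt0//; lra.
have emu : 1 + e = mu * (1 - e) by rewrite /e; field; lra.
pose near_pt (f : Y -> R) d y := `|f y0 - f y| < d.
have near_nbhs f d : 0 < d -> continuous f -> nbhs y0 (near_pt f d).
  move=> d0 fc; have : nbhs y0 (f @^-1` ball (f y0) d) by apply: fc; exact: nbhsx_ballx.
  by apply: (@filterS _ _ (nbhs_filter y0)) => y; rewrite -ball_normE.
have ReC f : continuous f -> continuous (fun y : Y => complex.Re (f y : C)).
  by move=> fc y; exact: (continuous_comp (fc y) (@Re_continuous _ _)).
have ImC f : continuous f -> continuous (fun y : Y => complex.Im (f y : C)).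
  by move=> fc y; exact: (continuous_comp (fc y) (@Im_continuous _ _)).
have h2 : 0 < 1 / 2 :> R by lra.
(* With k = 0, two equivalent points of this set differ by a translation c with |s1(c)| < 1 and with
   both parts of s2(c) below 1/2 in absolute value. The norm of c is then below 1/2, so c = 0. *)
exists (near_pt (fun y => complex.Im (zcoord y)) (e * I) `&`
   near_pt (fun y => complex.Re (zcoord y)) (1 / 2) `&`
   near_pt (fun y => complex.Re (wcoord y)) (1 / 2 / 2) `&`
   near_pt (fun y => complex.Im (wcoord y)) (1 / 2 / 2)).
  apply: filterI; last by apply: near_nbhs; [lra | exact/ImC/wcoord_continuous].
  apply: filterI; last by apply: near_nbhs; [lra | exact/ReC/wcoord_continuous].
  apply: filterI; last by apply: near_nbhs => //; exact/ReC/zcoord_continuous.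
  by apply: near_nbhs; [exact: mulr_gt0 | exact/ImC/zcoord_continuous].
move=> y y' [[[Wi Wr] Wwr] Wwi] [[[Wi' Wr'] Wwr'] Wwi'] /OT_projP[[c k] cky].
have Ez := congr1 (@zcoord R) cky; rewrite zcoord_action /= in Ez.
have Ew := congr1 (@wcoord R) cky; rewrite wcoord_action /= in Ew.
have k0 : k = 0.
  apply/eqP; apply: contraT => /gap; rewrite -fmorphXz.
  have := congr1 (@complex.Im R) Ez; rewrite raddfD /= Im_scale addr0.
  move: Wi Wi'; rewrite /near_pt -/I.
  move: (complex.Im (zcoord y)) (complex.Im (zcoord y')) (zcoord_Im_gt0 y) => i i' i0.
  rewrite !ltr_norml.
  move: (s1 (v ^ k)) => l /andP[h1 h3] /andP[h4 h5] i'E.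
  have hi : mu * ((1 - e) * I) < mu * i by rewrite ltr_pM2l; lra.
  have hi' : mu * ((1 - e) * I) < mu * i' by rewrite ltr_pM2l; lra.
  rewrite mulrA -emu in hi hi'.
  case=> hl.
    have : mu * i <= l * i by rewrite ler_pM2r.
    by rewrite i'E; lra.
  have : mu * l * i <= 1 * i by rewrite ler_pM2r.
  by rewrite -mulrA i'E; lra.
rewrite k0 expr0z in Ez Ew.
suff c0 : c = 0 by rewrite -cky c0 k0 OT_action1.
apply: (lat_eq0 b_unit); apply: (small_int_eq0 b_int b_unit b_span).
  exact: lat_is_int.
have Er := congr1 (@complex.Re R) Ez; rewrite rmorph1 mul1r raddfD /= in Er.
have Ewr := congr1 (@complex.Re R) Ew; rewrite rmorph1 mul1r raddfD /= in Ewr.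
have Ewi := congr1 (@complex.Im R) Ew; rewrite rmorph1 mul1r raddfD /= in Ewi.
move: Wr Wr' Wwr Wwr' Wwi Wwi'; rewrite /near_pt -Er -Ewr -Ewi {Er Ewr Ewi}.
case: (s2 _) => p q /=; move: (s1 (lat c)) => r; rewrite !ltr_norml.
move=> /andP[? ?] /andP[? ?] /andP[? ?] /andP[? ?] /andP[? ?] /andP[? ?].
have r1 : `|r| < 1 by rewrite ltr_norml; apply/andP; split; lra.
have p1 : `|p| < 1 / 2 by rewrite ltr_norml; apply/andP; split; lra.
have q1 : `|q| < 1 / 2 by rewrite ltr_norml; apply/andP; split; lra.
rewrite sqr_sqrtr ?addr_ge0 ?sqr_ge0// -(real_normK (num_real p)) -(real_normK (num_real q)).
have := normr_ge0 r; have := normr_ge0 p; have := normr_ge0 q.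
move: `|r| `|p| `|q| r1 p1 q1 => r' p' q' r1 p1 q1 q0 p0 r0.
have pq : p' ^+ 2 + q' ^+ 2 <= 1 / 2 by nra.
have := sqr_ge0 p'; have := sqr_ge0 q'; move: (p' ^+ 2) (q' ^+ 2) pq => P Q; nra.
Qed.

Context (N : 'M[int]_3).
Hypothesis lat_N : forall a, lat (a *m N) = (v - 1) * lat a.

(** The ideal generated by v - 1 in O_K, in the coordinates of the integral basis. *)
Definition in_image : {pred 'rV[int]_3} := [pred x | `[< exists a, x = a *m N >]].

Lemma in_image_zmod_closed : zmod_closed in_image.
Proof.
split=> [|x y]; first by apply/asboolP; exists 0; rewrite mul0mx.
move=> /asboolP[a ->] /asboolP[c ->]; apply/asboolP.
by exists (a - c); rewrite mulmxBl.
Qed.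

HB.instance Definition _ :=
  GRing.isZmodClosed.Build 'rV[int]_3 in_image in_image_zmod_closed.

Definition coker : zmodType := Quotient.quot in_image.

Definition coker_class (x : 'rV[int]_3) : coker := (\pi_coker x)%qT.

Lemma coker_classD : {morph coker_class : x y / x + y}.
Proof. by move=> x y; rewrite /coker_class raddfD. Qed.

Lemma coker_class_eq x y : coker_class x = coker_class y <-> exists a, x - y = a *m N.
Proof.
have E : (x - y \in in_image) = (x == y %[mod coker])%qT by exact: Quotient.idealrBE.
split=> [/eqP|xy]; first by rewrite /coker_class -E => /asboolP.
by apply/eqP; rewrite /coker_class -E; apply/asboolP.
Qed.

Lemma twistD k m c : twist (k + m) c = twist k (twist m c).
Proof. by apply: (lat_inj b_unit); rewrite !lat_twist expfzDr// mulrA. Qed.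

Lemma twist0 c : twist 0 c = c.
Proof. by apply: (lat_inj b_unit); rewrite lat_twist expr0z mul1r. Qed.

Lemma coker_class_twist1 c : coker_class (twist 1 c) = coker_class c.
Proof.
apply/coker_class_eq; exists c; apply: (lat_inj b_unit).
by rewrite latB lat_twist lat_N expr1z mulrBl mul1r.
Qed.

Lemma coker_class_twist k c : coker_class (twist k c) = coker_class c.
Proof.
elim/int_ind: k c => [c|n IH c|n IH c]; first by rewrite twist0.
  by rewrite -addn1 PoszD twistD IH coker_class_twist1.
rewrite -addn1 PoszD opprD twistD IH -(coker_class_twist1 (twist (- 1) c)).
by rewrite -twistD subrr twist0.
Qed.

Definition abelianization (g : G) : coker * int := (coker_class g.1, g.2).

Lemma abelianization_mul g h :
  abelianization (OT_mul g h) = abelianization g + abelianization h.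
Proof. by congr (_, _); rewrite /= coker_classD coker_class_twist. Qed.

Lemma abelianization_surj x : exists g, abelianization g = x.
Proof.
case: x => q k; exists (repr q, k); congr (_, _).
exact: reprK.
Qed.

(* [(v - 1) c] is a commutator of [c] and [v] in the semidirect product. *)
Lemma abelianization_ker (M : zmodType) (psi : G -> M) :
  (forall g h, psi (OT_mul g h) = psi g + psi h) ->
  forall g, abelianization g = 0 -> psi g = 0.
Proof.
move=> psiM [a k] [a0 ->].
have [c aE] : exists c, a = twist 1 c - c.
  have /coker_class_eq[c] : coker_class a = coker_class 0.
    by rewrite a0 /coker_class raddf0.
  rewrite subr0 => ->; exists c; apply: (lat_inj b_unit).
  by rewrite latB lat_twist lat_N expr1z mulrBl mul1r.
have l0 m : twist m 0 = 0.
  by apply: (lat_eq0 b_unit); rewrite lat_twist; have := latB b 0 0; rewrite !subrr => ->; rewrite mulr0.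
have psiD x y : psi (x + y, 0) = psi (x, 0) + psi (y, 0).
  by rewrite -psiM /OT_mul /= twist0 addr0.
have comm : psi (twist 1 c, 0) = psi (c, 0).
  apply: (addrI (psi (0, 1))); rewrite [LHS]addrC -!psiM /OT_mul /=.
  by rewrite l0 addr0 add0r addr0 add0r.
by apply: (addIr (psi (c, 0))); rewrite -psiD aE subrK comm add0r.
Qed.

Lemma OT_H1_iso : exists Phi : H1 R X -> coker * int,
  [/\ {morph Phi : x y / x - y}, injective Phi & forall z, exists x, Phi x = z].
Proof.
apply: (H1_quotient_iso (@half_plane_hausdorff R) OT_proj_continuous OT_proj_open
  OT_proj_inj OT_proj_surj OT_action_continuous OT_action_mul OT_action_free
  _ _ (@hmix0 R) (@hmix1 R) (@hmixxx R) OT_action_mix (@hmix_continuous R)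
  abelianization_mul abelianization_surj abelianization_ker).
- by move=> g y; apply/esym/OT_projP; exists g.
- by move=> y y' /OT_projP.
- have h : 0 < complex.Im ('i%C : C) by rewrite /= ltr01.
  exact: (half_plane_point 0 h).
Qed.

(** The factor Z has no torsion, while the cokernel is killed by det N, because a adj(N) N = det(N)
    a. The torsion is thus exactly the cokernel, which [coker_card] counts. *)
Lemma OT_H1_torsion : \det N != 0 ->
  finite_set (torsion (H1 R X)) /\
  #|` fset_set (torsion (H1 R X))|%fset = absz (\det N).
Proof.
move=> dN; have [Phi [PhiB Phi_inj Phi_surj]] := OT_H1_iso.
have [T [f [fE f_surj cardT]]] := coker_card dN.
pose aPhi : {additive H1 R X -> (coker * int)%type} :=
  HB.pack Phi (GRing.isZmodMorphism.Build _ _ Phi PhiB).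
have PhiMn x m : Phi (x *+ m) = Phi x *+ m by exact: (raddfMn aPhi).
have Phi0 : Phi 0 = 0 by exact: (raddf0 aPhi).
have torsionE x : torsion (H1 R X) x <-> (Phi x).2 = 0.
  split=> [[m m0 xm]|x0].
    have /(congr1 snd) := PhiMn x m; rewrite xm Phi0 /= => /esym/eqP.
    by rewrite raddfMn /= mulrn_eq0 gtn_eqF//= => /eqP.
  have [a aE] : exists a, coker_class a = (Phi x).1 by exists (repr (Phi x).1); exact: reprK.
  exists (absz (\det N)); first by rewrite absz_gt0.
  apply: Phi_inj; rewrite PhiMn Phi0.
  apply/eqP; rewrite -pair_eqE /= !raddfMn /= x0 mul0rn eqxx andbT -aE.
  have -> : coker_class a *+ absz (\det N) = coker_class (a *+ absz (\det N)).
    by rewrite /coker_class raddfMn.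
  have <- : coker_class 0 = 0 by rewrite /coker_class raddf0.
  apply/eqP/coker_class_eq; rewrite subr0.
  have h : a *m \adj N *m N = \det N *: a by rewrite -mulmxA mul_adj_mx mul_mx_scalar.
  have [d0|d0] := leP 0 (\det N).
    exists (a *m \adj N); rewrite h -[in RHS](gez0_abs d0).
    by rewrite -scaler_nat natz.
  exists (- (a *m \adj N)); rewrite mulNmx h -scaleNr -(ltz0_abs d0).
  by rewrite -scaler_nat natz.
have ex t : exists x, exists2 a, f a = t & Phi x = (coker_class a, 0).
  by have [a fa] := f_surj t; have [x xE] := Phi_surj (coker_class a, 0); exists x, a.
have [g gP] := choice ex.
have g_inj : injective g.
  move=> t t' gt; have [a fa ga] := gP t; have [a' fa' ga'] := gP t'.
  by rewrite -fa -fa'; apply/fE/coker_class_eq; move: ga; rewrite gt ga' => -[].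
pose F : {fset H1 R X} := [fset x in [seq g t | t <- enum T]]%fset.
have FE : torsion (H1 R X) = [set` F].
  apply/seteqP; split=> x /=.
    move=> /torsionE x0; rewrite /F !inE; apply/mapP.
    have [a aE] : exists a, coker_class a = (Phi x).1 by exists (repr (Phi x).1); exact: reprK.
    exists (f a); first by rewrite mem_enum.
    have [a' /fE/coker_class_eq aa' ga'] := gP (f a).
    by apply: Phi_inj; rewrite ga' aa' aE -x0; case: (Phi x).
  rewrite /F !inE => /mapP[t _ ->]; apply/torsionE.
  by have [a _ ->] := gP t.
rewrite FE; split; first exact: finite_fset.
rewrite set_fsetK card_fseq undup_id; first by rewrite size_map -cardE cardT.
by rewrite map_inj_uniq ?enum_uniq.
Qed.

End OT_quotient.
(** * Growth of the norm *)

Section growth.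
Context (R : realType).

Lemma cvg_cst_div_nat (c : R) : (fun n : nat => c / n%:R) @ \oo --> (0 : R).
Proof.
rewrite -(@cvg_shiftS R^o).
have -> : [sequence c / n.+1%:R]_n = (fun n => c * harmonic n) by [].
have : (fun n => c * harmonic n) @ \oo --> c * 0.
  by apply: cvgMl_tmp; exact: cvg_harmonic.
by rewrite mulr0.
Qed.

(** After taking logarithms and dividing by n, the constants contribute only ln A / n and ln B / n,
    which tend to 0. *)
Lemma cvg_ln_geometric (c : nat -> R) (M A B : R) : 0 < A -> 0 < M ->
  (forall n, (0 < n)%N -> A * M ^+ n <= c n <= B * M ^+ n) ->
  (fun n : nat => ln (c n) / n%:R) @ \oo --> ln M.
Proof.
move=> A0 M0 cP.
have B0 : 0 < B.
  have /andP[h1 h2] := cP 1%N isT.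
  by have := le_trans h1 h2; rewrite ler_pM2r ?exprn_gt0//; exact: lt_le_trans.
have cvgE (a : R) : (fun n : nat => a / n%:R + ln M) @ \oo --> ln M.
  have : (fun n : nat => a / n%:R + ln M) @ \oo --> 0 + ln M.
    by apply: cvgD; [exact: cvg_cst_div_nat | exact: cvg_cst].
  by rewrite add0r.
apply: (squeeze_cvgr _ (cvgE (ln A)) (cvgE (ln B))).
exists 1%N => // n /= n1; have n0 : (0 : R) < n%:R by rewrite ltr0n.
have Mn := exprn_gt0 n M0.
have /andP[h1 h2] := cP n n1.
have c0 : 0 < c n by apply: lt_le_trans h1; exact: mulr_gt0.
have lnE (a : R) : 0 < a -> ln a / n%:R + ln M = ln (a * M ^+ n) / n%:R.
  move=> a0; rewrite lnM ?posrE// lnXn// mulrDl; congr (_ + _).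
  by rewrite -(mulr_natr (ln M)) mulfK// gt_eqF.
by rewrite !lnE// !ler_pM2r ?invr_gt0// !ler_ln ?posrE ?h1 ?h2 ?mulr_gt0.
Qed.

Lemma normc_subr1_bounds (z : R[i]) :
  `|Normc.normc z - 1| <= Normc.normc (z - 1) <= Normc.normc z + 1.
Proof.
have tri (x y : R[i]) : Normc.normc (x + y) <= Normc.normc x + Normc.normc y.
  by rewrite -lecR rmorphD /=; exact: (@ler_normD _ R[i]).
have opp (x : R[i]) : Normc.normc (- x) = Normc.normc x.
  by case: x => a b /=; rewrite !sqrrN.
have := tri z (- 1); have := tri z (- (z - 1)); have := tri 1 (z - 1).
rewrite !opp opprB ![_ + (_ - _)]addrC !subrK Normc.normc1 => h1 h2 ->.
by rewrite ler_distl lerBlDr andbT; apply/andP.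
Qed.

End growth.

(** * The Mahler measure in terms of the conjugates of u *)

Section mahler_measure.
Context (K : fieldExtType rat) (R : realType) (sigma : embeddings K R 1 1).
Context (u : K) (f : {poly rat}).
Hypotheses (u_gen : <<1; u>>%VS = {:K}%VS)
  (hf : map_poly (GRing.in_alg K) f = minPoly 1%VS u).

(** The roots of f are the three distinct conjugates of u; the two nonreal ones have equal modulus,
    hence the square. *)
Lemma mahler_conjugates : mahler (map_poly ratr f : {poly R[i]}) =
  Num.max 1 `|sigma1 sigma u| * Num.max 1 (Normc.normc (sigma2 sigma u)) ^+ 2.
Proof.
rewrite /mahler; case: closed_field_poly_normal => rs /= rsE.
pose al := codom (fun j => tau sigma j u).
have fE : map_poly ratr f = \prod_(z <- al) ('X - z%:P) :> {poly R[i]}.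
  by rewrite (minPoly_conjugates sigma u_gen hf) /al /codom /image_mem big_map big_enum.
have al_uniq : uniq al by rewrite map_inj_uniq ?enum_uniq//; exact: tau_gen_inj.
have lead1 : lead_coef (map_poly ratr f : {poly R[i]}) = 1.
  by rewrite fE lead_coef_prod_XsubC.
rewrite lead1 scale1r in rsE.
have rs_al : perm_eq rs al.
  apply: uniq_perm => // [|z].
    by rewrite -separable_prod_XsubC -rsE fE separable_prod_XsubC.
  by rewrite -!root_prod_XsubC -rsE fE.
rewrite (perm_big _ rs_al) /= /al /codom /image_mem big_map big_enum /=.
rewrite !big_ord_recl big_ord0 mulr1 tau_ord0 tau_ord1.
rewrite (_ : lift _ _ = ord_max) ?tau_ord2; last exact: val_inj.
have -> : Normc.normc (conjc (sigma2 sigma u)) = Normc.normc (sigma2 sigma u).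
  by case: (sigma2 _ _) => a b /=; rewrite sqrrN.
by rewrite -expr2 /= expr0n addr0 sqrtr_sqr.
Qed.

End mahler_measure.
Section norm_growth.
Context (R : realType).

(* Since [l * |z|^2 = 1], exactly one of [l], [|z|^2] exceeds 1; it is the measure [M]. *)
Lemma conjugate_norm_growth (l : R) (z : R[i]) :
  0 < l -> l != 1 -> l * Normc.normc z ^+ 2 = 1 ->
  let M := Num.max 1 l * Num.max 1 (Normc.normc z) ^+ 2 in
  1 < M /\ exists A B : R, 0 < A /\ forall n, (0 < n)%N ->
    A * M ^+ n <= `|l ^+ n - 1| * Normc.normc (z ^+ n - 1) ^+ 2 <= B * M ^+ n.
Proof.
move=> l0 l1 lz /=; set r := Normc.normc z in lz *; set M := Num.max 1 l * _.
have r_ge0 : 0 <= r := normc_nonneg z.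
have r0 : 0 < r.
  rewrite lt0r r_ge0 andbT; apply/eqP => r0.
  by move: lz; rewrite r0 expr0n mulr0 => /eqP; rewrite eq_sym oner_eq0.
have normcX n : Normc.normc (z ^+ n) = r ^+ n.
  elim: n => [|n IH]; first by rewrite !expr0 Normc.normc1.
  by rewrite !exprS Normc.normcM IH.
have zb n : `|r ^+ n - 1| <= Normc.normc (z ^+ n - 1) <= r ^+ n + 1.
  by rewrite -normcX; exact: normc_subr1_bounds.
have [l_gt1|l_lt1|l_eq1] := ltgtP 1 l; last by rewrite -l_eq1 eqxx in l1.
- have r_lt1 : r < 1.
    rewrite ltNge; apply/negP => r1; suff : 1 < l * r ^+ 2 by rewrite lz ltxx.
    by rewrite (lt_le_trans l_gt1)// ler_peMr ?exprn_ege1// ltW.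
  have -> : M = l.
    by rewrite /M (max_idPr (ltW l_gt1)) (max_idPl (ltW r_lt1)) expr1n mulr1.
  (* Here l > 1 > r. The real factor lies between (1 - 1/l) l^n and l^n, and |z^n - 1| lies between
     1 - r and 2, so its square is at most 4. *)
  split=> //; exists ((1 - l^-1) * (1 - r) ^+ 2), 4; split.
    by rewrite mulr_gt0 ?exprn_gt0 ?subr_gt0// invf_lt1.
  move=> n n0; have ln1 : 1 <= l ^+ n := exprn_ege1 n (ltW l_gt1).
  have rn1 : r ^+ n <= r by case: n n0 {ln1} => // n _; rewrite exprS ler_piMr// exprn_ile1// ltW.
  have lnl : l <= l ^+ n by case: n n0 {ln1 rn1} => // n _; rewrite exprS ler_peMr ?(ltW l0)// exprn_ege1// ltW.
  have rn0 : 0 <= r ^+ n by rewrite exprn_ge0.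
  have /andP[] := zb n; rewrite ler0_norm ?subr_le0 ?(le_trans rn1 (ltW r_lt1))//.
  rewrite ger0_norm ?subr_ge0//; move: (Normc.normc (z ^+ n - 1)) => N N1 N2.
  have hN : (1 - r) ^+ 2 <= N ^+ 2 by rewrite ler_sqr ?nnegrE; lra.
  have hN' : N ^+ 2 <= 2 ^+ 2 by rewrite ler_sqr ?nnegrE; lra.
  apply/andP; split.
    rewrite mulrAC; apply: ler_pM => //.
    - by rewrite mulr_ge0 ?subr_ge0 ?invf_le1 ?(ltW l_gt1)// (le_trans _ ln1).
    - exact: sqr_ge0.
    - rewrite mulrBl mul1r lerD2l lerN2 mulrC ler_pdivlMr// mul1r.
      exact: lnl.
  rewrite mulrC; apply: ler_pM; rewrite ?sqr_ge0 ?subr_ge0//; first lra.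
  lra.
- have r_gt1 : 1 < r.
    rewrite ltNge; apply/negP => r1; suff : l * r ^+ 2 < 1 by rewrite lz ltxx.
    by apply: le_lt_trans l_lt1; rewrite ler_piMr ?(ltW l0)// exprn_ile1.
  have -> : M = r ^+ 2.
    by rewrite /M (max_idPl (ltW l_lt1)) (max_idPr (ltW r_gt1)) mul1r.
  split; first by rewrite exprn_egt1.
  (* Here l < 1 < r. The real factor lies between 1 - l and 1, and |z^n - 1| lies between (1 - 1/r)
     r^n and 2 r^n; squaring the latter bounds gives multiples of M^n with M = r^2. *)
  exists ((1 - l) * (1 - r^-1) ^+ 2), 4; split.
    by rewrite mulr_gt0 ?exprn_gt0 ?subr_gt0// invf_lt1.
  move=> n n0; have rn1 : 1 <= r ^+ n := exprn_ege1 n (ltW r_gt1).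
  have lnl : l ^+ n <= l by case: n n0 {rn1} => // n _; rewrite exprS ler_piMr ?(ltW l0)// exprn_ile1// ltW.
  have rnr : r <= r ^+ n by case: n n0 {rn1 lnl} => // n _; rewrite exprS ler_peMr// exprn_ege1// ltW.
  have ln0 : 0 <= l ^+ n by rewrite exprn_ge0// ltW.
  have /andP[] := zb n; rewrite ger0_norm ?subr_ge0//.
  rewrite ler0_norm ?subr_le0 ?(le_trans lnl (ltW l_lt1))//.
  move: (Normc.normc (z ^+ n - 1)) => N N1 N2.
  rewrite -exprM mulnC exprM.
  have hr : (1 - r^-1) * r ^+ n <= r ^+ n - 1.
    by rewrite mulrBl mul1r lerD2l lerN2 mulrC ler_pdivlMr// mul1r.
  have hr0 : 0 <= (1 - r^-1) * r ^+ n.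
    by rewrite mulr_ge0 ?exprn_ge0// subr_ge0 invf_le1// ltW.
  have hN : ((1 - r^-1) * r ^+ n) ^+ 2 <= N ^+ 2 by rewrite ler_sqr ?nnegrE; lra.
  have hN' : N ^+ 2 <= (2 * r ^+ n) ^+ 2 by rewrite ler_sqr ?nnegrE; lra.
  apply/andP; split.
    rewrite -mulrA -exprMn; apply: ler_pM => //; rewrite ?subr_ge0 ?(ltW l_lt1) ?sqr_ge0//.
    lra.
  have -> : 4 * (r ^+ n) ^+ 2 = 1 * (2 * r ^+ n) ^+ 2 by ring.
  by apply: ler_pM => //; rewrite ?sqr_ge0//; lra.
Qed.

End norm_growth.

(** * Admissibility of the subgroups, and the limit *)

Section admissibility.
Context (K : fieldExtType rat) (R : realType) (sigma : embeddings K R 1 1).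
Context (u : K).
Hypotheses (hu_gen : pos_units sigma = cyclic_subgroup u)
  (hu_inf : injective (fun m : int => u ^ m)).

Lemma fundamental_unit : [/\ u != 0, is_int u, is_int u^-1 & 0 < sigma1 sigma u].
Proof.
have : pos_units sigma u by rewrite hu_gen; exists 1 => //; rewrite expr1z.
by move=> [u0 ui uVi /(_ ord0)].
Qed.

Lemma ln_exprz (x : R) (m : int) : 0 < x -> ln (x ^ m) = m%:~R * ln x.
Proof.
move=> x0; case: m => m.
  by rewrite -exprnP lnXn// mulr_natl.
have -> : x ^ Negz m = (x ^+ m.+1)^-1 by [].
by rewrite lnV ?posrE ?exprn_gt0// lnXn// NegzE rmorphN mulNr mulr_natl.
Qed.

Lemma sigma1_fundamental_neq1 : sigma1 sigma u != 1.
Proof.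
apply/eqP => s1; have u1 : u = 1 by apply: (fmorph_inj (sigma1 sigma)); rewrite s1 rmorph1.
by have /hu_inf : u ^ 0 = u ^ 1 by rewrite expr0z expr1z u1.
Qed.

Lemma cyclic_subgroup_admissible n : (0 < n)%N ->
  admissible sigma (cyclic_subgroup (u ^+ n)).
Proof.
move=> n0; have [u0 _ _ u_pos] := fundamental_unit.
have v0 : u ^+ n != 0 by rewrite expf_neq0.
have vE (m : int) : (u ^+ n) ^ m = u ^ (n%:Z * m) by rewrite exprnP exprz_exp.
split.
- by rewrite hu_gen => _ [m _ <-]; exists (n%:Z * m).
- split; first by exists 0.
    by move=> _ _ [m _ <-] [m' _ <-]; exists (m + m') => //; rewrite expfzDr.
  by move=> _ [m _ <-]; exists (- m) => //; rewrite invr_expz.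
- exists (fun=> u ^+ n); split.
    apply/seteqP; split=> w.
      by move=> [m _ <-]; exists (fun=> m); rewrite big_ord1.
    by move=> [m ->]; exists (m ord0) => //; rewrite big_ord1.
  move=> m m'; rewrite !big_ord1 !vE => /hu_inf mm' j; rewrite (ord1 j).
  by apply: (mulfI _ mm'); rewrite eqz_nat -lt0n.
(* In dimension one a full lattice is spanned by one nonzero number; this logarithm is nonzero
   because s1(u) is positive and different from 1. *)
- exists (ln (sigma1 sigma (u ^+ n)))%:M.
    rewrite unitmxE det_scalar expr1 unitfE ln_eq0 rmorphXn ?exprn_gt0//.
    by rewrite pexpr_eq1 ?(ltW u_pos)// sigma1_fundamental_neq1.
  apply/seteqP; split=> w.
    move=> [_ [m _ <-] <-]; exists (const_mx m); apply/rowP => j.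
    rewrite (ord1 j) mul_mx_scalar !mxE fmorphXz ln_exprz; first by rewrite mulrC.
    by rewrite rmorphXn exprn_gt0.
  move=> [m ->]; exists ((u ^+ n) ^ (m ord0 ord0)); first by exists (m ord0 ord0).
  apply/rowP => j; rewrite (ord1 j) mul_mx_scalar !mxE fmorphXz ln_exprz; first by rewrite mulrC.
  by rewrite rmorphXn exprn_gt0.
Qed.

End admissibility.

Theorem theorem3 (R : realType) (K : fieldExtType rat)
    (sigma : embeddings K R 1 1) (u : K) (f : {poly rat})
    (hu_gen : pos_units sigma = cyclic_subgroup u)
    (hu_inf : injective (fun m : int => u ^ m))
    (hf : map_poly (GRing.in_alg K) f = minPoly 1%VS u) :
  let U (n : nat) : set K := cyclic_subgroup (u ^+ n) in
  let H1tor (n : nat) := torsion (H1 R (OT_manifold sigma (U n))) in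
  let M : R := mahler (map_poly ratr f) in
  [/\ forall n : nat, (0 < n)%N -> admissible sigma (U n),
      forall n : nat, (0 < n)%N -> finite_set (H1tor n),
      (fun n : nat => ln (#|` fset_set (H1tor n)|%fset%:R : R) / n%:R)
        @ \oo --> ln M
    & 0 < ln M].
Proof.
move=> U H1tor M.
have [u0 ui uVi u_pos] := fundamental_unit hu_gen.
have s1u := sigma1_fundamental_neq1 sigma hu_inf.
(* Excludes 1 and -1, the only rational units, so that u generates K. *)
have u2 : u ^+ 2 != 1.
  by apply/eqP => u2; have /hu_inf : u ^ (2%:Z) = u ^ 0 by rewrite -exprnP u2 expr0z.
have u_gen := unit_generates sigma u0 ui uVi u2.
have [b [b_int b_unit b_span]] := integral_basis sigma u_gen ui.
have norm1 := norm_unit b_int b_unit b_span ui uVi u0 u_pos.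
have ME : M = Num.max 1 (sigma1 sigma u) * Num.max 1 (Normc.normc (sigma2 sigma u)) ^+ 2.
  by rewrite /M (mahler_conjugates sigma u_gen hf) gtr0_norm.
have [M1 [A [B [A0 AB]]]] := conjugate_norm_growth u_pos s1u norm1.
rewrite -ME in M1 AB.
have tors n : (0 < n)%N -> finite_set (H1tor n) /\
    (#|` fset_set (H1tor n)|%fset%:R : R) =
    `|sigma1 sigma u ^+ n - 1| * Normc.normc (sigma2 sigma u ^+ n - 1) ^+ 2.
  move=> n0; have v0 : u ^+ n != 0 by rewrite expf_neq0.
  have vi : is_int (u ^+ n) by exact: is_intX.
  have vVi : is_int (u ^+ n)^-1 by rewrite -exprVn; exact: is_intX.
  have v_pos : 0 < sigma1 sigma (u ^+ n) by rewrite rmorphXn exprn_gt0.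
  have v1 : sigma1 sigma (u ^+ n) != 1 by rewrite rmorphXn pexpr_eq1 ?(ltW u_pos).
  have wi : is_int (u ^+ n - 1) by apply: is_intB => //; exact: (is_int_intr _ 1).
  have [N [NE detN]] := mult_mx_ex b_int b_unit b_span wi.
  have detE : (\det N)%:~R = sigma1 sigma (u ^+ n - 1) * Normc.normc (sigma2 sigma (u ^+ n - 1)) ^+ 2 :> R.
    by apply: (fmorph_inj (real_complex R)); rewrite rmorph_int detN prod_tau.
  have w0 : u ^+ n - 1 != 0.
    by rewrite subr_eq0; apply: contra v1 => /eqP ->; rewrite rmorph1.
  have dN : \det N != 0.
    rewrite -(intr_eq0 R) detE mulf_neq0 ?fmorph_eq0// expf_neq0//.
    by apply: contra w0 => /eqP/Normc.eq0_normc/eqP; rewrite fmorph_eq0.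
  have [fin card] := OT_H1_torsion b_int b_unit b_span v0 vi vVi v_pos v1 NE dN.
  split=> //; rewrite card -[LHS]/((absz (\det N))%:~R) abszE intr_norm detE normrM.
  rewrite !rmorphB !rmorphXn !rmorph1 [X in _ * X]ger0_norm//.
  by rewrite exprn_ge0 ?normc_nonneg.
split.
- by move=> n n0; exact: cyclic_subgroup_admissible.
- by move=> n n0; have [] := tors n n0.
- apply: (cvg_ln_geometric A0 (lt_trans ltr01 M1)) => n n0.
  by have [_ ->] := tors n n0; exact: AB.
- exact: ln_gt0.
Qed.
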